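(* Let $\mathcal{E}$ be either the set $\{0,2,4,\ldots\}$ of nonnegative even integers or the set $\{1,3,5,\ldots\}$ of nonnegative odd integers, and let $\mathcal{E}^c:=\mathbb{N}_0\setminus\mathcal{E}$. Suppose that $f\in\mathscr{F}(\mathbb{C})$ satisfies \[ f^{(j)}(0)=0\quad\text{for all } j\in\mathcal{E}, \] while for some point $\beta\in\mathbb{C}$ it holds that \[ (\mathbf{U}_\beta f)^{(j)}(0)=0\quad\text{for all } j\in\mathcal{E}^c. \] Then $f=0$ identically.
   Context: $\mathbb{N}_0:=\{0,1,2,\ldots\}$. The Bargmann-Fock space $\mathscr{F}(\mathbb{C})$ is the Hilbert space of all entire functions $f:\mathbb{C}\to\mathbb{C}$ with \[ \|f\|^2_{\mathscr{F}(\mathbb{C})}:=\int_{\mathbb{C}}|f(z)|^2\,e^{-|z|^2}\,\mathrm{dA}(z)<+\infty,\qquad \mathrm{dA}(z):=\pi^{-1}\,\mathrm{d}x\,\mathrm{d}y,\quad z=x+\mathrm{i}y. \] For $\beta\in\mathbb{C}$, the Fock translate of $f\in\mathscr{F}(\mathbb{C})$ is \[ \mathbf{U}_\beta f(z):=e^{-\frac12|\beta|^2+\bar\beta z}f(z-\beta),\qquad z\in\mathbb{C}, \] and $\mathbf{U}_\beta$ is a unitary operator on $\mathscr{F}(\mathbb{C})$. Here $g^{(j)}(0)$ denotes the $j$-th complex derivative of $g$ at $0$. *)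

(* Defs.v *)
From HB Require Import structures.
From mathcomp Require Import all_boot all_order all_algebra.
From mathcomp Require Import complex.
From mathcomp Require Import all_classical all_reals all_analysis.

Set Implicit Arguments.
Unset Strict Implicit.
Unset Printing Implicit Defensive.

Import Order.TTheory GRing.Theory Num.Theory.
Import numFieldNormedType.Exports.
Import ComplexField.Normc.

Local Open Scope classical_set_scope.
Local Open Scope ring_scope.
Local Open Scope complex_scope.

Definition expC (R : realType) (z : R[i]) : R[i] :=
  (expR (complex.Re z))%:C * (cos (complex.Im z) +i* sin (complex.Im z)).

(* The field R[i] carries its normed-module (hence topological) structure
   through the regular module R[i]^o; over the scalar field R[i],
   [derivable _ z 1] is complex differentiability at z, and [derive1n] iterates
   the complex derivative. *)
Definition entire (R : realType) (f : R[i]^o -> R[i]^o) : Prop :=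
  forall z : R[i]^o, derivable f z 1.

Definition fock_sqnorm (R : realType) (f : R[i]^o -> R[i]^o) : \bar R :=
  ((pi^-1)%:E *
   \int[lebesgue_measure \x lebesgue_measure]_(p in [set: R * R])
     (normc (f (p.1 +i* p.2)) ^+ 2 *
      expR (- normc (p.1 +i* p.2) ^+ 2))%:E)%E.

Definition fock_space (R : realType) : set (R[i]^o -> R[i]^o) :=
  [set f | entire f /\ (fock_sqnorm f < +oo)%E].

Definition fock_translate (R : realType) (beta : R[i])
    (f : R[i]^o -> R[i]^o) : R[i]^o -> R[i]^o :=
  fun z => expC ((- (normc beta ^+ 2 / 2))%:C + beta^* * z) * f (z - beta).

(* Main.v *)
Require Import Defs.
From mathcomp Require Import all_boot all_order all_algebra.
From mathcomp Require Import complex.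
From mathcomp Require Import all_classical all_reals all_analysis.
From mathcomp Require Import ring lra.

(** The idea is to turn the vanishing of derivatives into symmetry.
  Since the Taylor coefficients of [f] of one parity vanish, [f] is even or odd,
  and the translate of [f] has the opposite parity. Eliminating the translate between
  the two symmetries gives, up to a sign,
  f(z + 2 beta) = exp(2 conj(beta) (z + beta)) f(z), so that the density
  |f(z)|^2 exp(-|z|^2) has period 2 beta ([fock_density_periodic]). A
  continuous nonnegative function with a nonzero period has infinite integral over
  the plane unless it vanishes ([periodic_integrable_eq0]), so f = 0. If beta = 0,
  then f is even and odd at once.

  Most of the work is the passage from derivatives to parity
  ([holomorphic_parity]), because being entire only means that complex difference
  quotients converge: that the iterated derivatives exist, and that they
  determine the function, is Cauchy's theory. Goursat's theorem for
  rectangles ([goursat_rectangle]) is proved by repeated quartering. Read in the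
  logarithmic coordinate it shows that means over concentric circles agree
  ([cauchy_annulus]). Applied to z (f(z) - f(a)) / (z - a), this yields Cauchy's
  formula; the singular point causes no trouble, because the mean depends
  continuously on the radius and cannot jump at the one circle through [a]
  ([cmean_slope]). Differentiating the formula under the integral sign gives all
  iterated derivatives as means over a circle ([derive1n_cauchy]), and expanding
  its kernel geometrically gives the convergence of the Taylor series
  ([taylor_cvg]). *)

Set Implicit Arguments.
Unset Strict Implicit.
Unset Printing Implicit Defensive.

Import Order.TTheory GRing.Theory Num.Theory.
Import numFieldNormedType.Exports.
Import ComplexField.Normc.

Local Open Scope classical_set_scope.
Local Open Scope ring_scope.
Local Open Scope complex_scope.

Local Notation Re := complex.Re.
Local Notation Im := complex.Im.

(** * Modulus and continuity of complex-valued functions *)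

Section ComplexNorm.
Variable R : realType.
Implicit Types (z w : R[i]) (x y : R).

Lemma normc_ge0 z : 0 <= normc z.
Proof. by case: z => x y; rewrite sqrtr_ge0. Qed.

Lemma normc_eq0 z : (normc z == 0) = (z == 0).
Proof.
apply/eqP/eqP => [/eq0_normc //|->].
exact: normc0.
Qed.

Lemma normc_gt0 z : (0 < normc z) = (z != 0).
Proof. by rewrite lt_def normc_ge0 andbT normc_eq0. Qed.

Lemma normc_real x : normc x%:C = `|x|.
Proof. by rewrite /= expr0n addr0 sqrtr_sqr. Qed.

Lemma sqr_normc z : normc z ^+ 2 = Re z ^+ 2 + Im z ^+ 2.
Proof. by case: z => x y; rewrite /= sqr_sqrtr // addr_ge0 ?sqr_ge0. Qed.

Lemma Re_le_normc z : `|Re z| <= normc z.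
Proof.
rewrite -(ler_pXn2r (_ : 0 < 2)%N) ?nnegrE ?normc_ge0 //.
by rewrite sqr_normc real_normK ?num_real// lerDl sqr_ge0.
Qed.

Lemma Im_le_normc z : `|Im z| <= normc z.
Proof.
rewrite -(ler_pXn2r (_ : 0 < 2)%N) ?nnegrE ?normc_ge0 //.
by rewrite sqr_normc real_normK ?num_real// lerDr sqr_ge0.
Qed.

Lemma normc_i : normc 'i%C = 1 :> R.
Proof. by rewrite /= expr0n add0r expr1n sqrtr1. Qed.

Lemma normc_le_ReIm z : normc z <= `|Re z| + `|Im z|.
Proof.
rewrite [z in normc z]complexE (le_trans (le_normcD _ _))// normcM normc_i mul1r.
by rewrite !normc_real.
Qed.

Lemma normcB z w : normc (z - w) = normc (w - z).
Proof. by rewrite -normcN opprB. Qed.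

Lemma normcX z n : normc (z ^+ n) = normc z ^+ n.
Proof.
elim: n => [|n IH]; first exact: normc1.
by rewrite !exprS normcM IH.
Qed.

Lemma ler_normcB z w : normc z - normc w <= normc (z - w).
Proof. by rewrite lerBlDr -{1}(subrK w z) le_normcD. Qed.

Lemma normc_small_eq0 z : (forall e, 0 < e -> normc z <= e) -> z = 0.
Proof.
move=> ze; apply/eqP; rewrite -normc_eq0 eq_le normc_ge0 andbT.
by apply/ler_addgt0Pl => e e0; rewrite addr0 ze.
Qed.

Lemma normc_norm z : `|z| = (normc z)%:C.
Proof. by rewrite normc_def; case: z. Qed.

(** The topology of the regular module is that of the complex ordered norm;
  this makes it available through discs of real radius. *)
Lemma nearC (p : R[i]^o) (P : R[i] -> Prop) :
  (\forall w \near p, P w) <->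
  exists2 d : R, 0 < d & forall w, normc (w - p) < d -> P w.
Proof.
split=> [/nbhs_normP[/= e e0 H]|[d d0 H]].
  have [e0' eE] : (0 < Re e) /\ e = (Re e)%:C.
    move: e0; rewrite ltcE /= => /andP[/eqP ie re]; split => //.
    by case: e ie re {H} => a b /= ->.
  exists (Re e) => // w wp; apply: H => /=.
  by rewrite distrC eE normc_norm ltcR.
apply/nbhs_normP; exists (d%:C) => /=; first by rewrite ltcR.
by move=> w /=; rewrite distrC normc_norm ltcR => /H.
Qed.

End ComplexNorm.

Section ContinuousAt.
Variable R : realType.

(** Continuity measured by the real-valued modulus, for an arbitrary domain:
  the same lemmas then serve for curves in the plane, for functions of a complex
  variable and for functions of two real variables. *)
Definition continuous_at (T : topologicalType) (g : T -> R[i]) (t : T) :=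
  forall e : R, 0 < e -> \forall s \near t, normc (g s - g t) < e.

Section Domain.
Variable T : topologicalType.
Implicit Types (g h : T -> R[i]) (t : T).

Lemma continuous_at_cst (c : R[i]) t : continuous_at (fun=> c) t.
Proof. by move=> e e0; apply: nearW => s; rewrite subrr normc0. Qed.

Lemma continuous_at_near g h t : g t = h t ->
  (\forall s \near t, g s = h s) -> continuous_at g t -> continuous_at h t.
Proof.
move=> gt gh cg e e0; near=> s.
have <- : g s = h s by near: s.
by rewrite -gt; near: s; exact: cg.
Unshelve. all: end_near. Qed.

Lemma continuous_atD g h t : continuous_at g t -> continuous_at h t ->
  continuous_at (fun s => g s + h s) t.
Proof.
move=> cg ch e e0; near=> s.
rewrite opprD addrACA (le_lt_trans (le_normcD _ _))// (splitr e) ltrD//.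
  by near: s; apply: cg; rewrite divr_gt0.
by near: s; apply: ch; rewrite divr_gt0.
Unshelve. all: end_near. Qed.

Lemma continuous_atM g h t : continuous_at g t -> continuous_at h t ->
  continuous_at (fun s => g s * h s) t.
Proof.
move=> cg ch e e0.
have k0 : 0 < 2 + normc (g t) + normc (h t).
  by rewrite -addrA ltr_wpDr ?addr_ge0 ?normc_ge0.
have d0 : 0 < Num.min 1 (e / (2 + normc (g t) + normc (h t))).
  by rewrite lt_min ltr01 divr_gt0.
near=> s.
have gs : normc (g s - g t) < Num.min 1 (e / (2 + normc (g t) + normc (h t))).
  by near: s; exact: cg.
have hs : normc (h s - h t) < Num.min 1 (e / (2 + normc (g t) + normc (h t))).
  by near: s; exact: ch.
move: gs hs; rewrite !lt_min => /andP[gs1 gs2] /andP[_ hs2].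
have -> : g s * h s - g t * h t =
  (g s - g t) * (h s - h t) + (g s - g t) * h t + g t * (h s - h t) by ring.
rewrite (le_lt_trans (le_normcD _ _))//.
rewrite (le_lt_trans (lerD (le_normcD _ _) (lexx _)))// !normcM.
set D := e / _ in gs2 hs2.
have De : D * (2 + normc (g t) + normc (h t)) = e.
  by rewrite /D divfK// gt_eqF.
have Dp : 0 < D by rewrite divr_gt0.
have := normc_ge0 (g s - g t); have := normc_ge0 (h s - h t).
have := normc_ge0 (g t); have := normc_ge0 (h t).
move: (normc (g s - g t)) (normc (h s - h t)) gs1 gs2 hs2 De.
move: (normc (g t)) (normc (h t)) => a b u v; nra.
Unshelve. all: end_near. Qed.

Lemma continuous_atV g t : g t != 0 -> continuous_at g t ->
  continuous_at (fun s => (g s)^-1) t.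
Proof.
move=> gt0 cg e e0.
have n0 : 0 < normc (g t) by rewrite normc_gt0.
near=> s.
have d1 : normc (g s - g t) < normc (g t) / 2.
  by near: s; apply: cg; rewrite divr_gt0.
have d2 : normc (g s - g t) < e * (normc (g t) ^+ 2 / 2).
  by near: s; apply: cg; rewrite mulr_gt0// divr_gt0// exprn_gt0.
have d3 : normc (g t) / 2 < normc (g s).
  have := ler_normcB (g t) (g s); rewrite normcB; lra.
have gs0 : g s != 0 by rewrite -normc_gt0 (lt_trans _ d3)// divr_gt0.
have -> : (g s)^-1 - (g t)^-1 = - (g s - g t) * ((g s)^-1 * (g t)^-1).
  by field; rewrite gs0 gt0.
rewrite normcM normcN normcM !normcV mulrA ltr_pdivrMr// ltr_pdivrMr; last first.
  by rewrite normc_gt0.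
rewrite (lt_trans d2)//.
have : 0 < e * normc (g t) * (normc (g s) - normc (g t) / 2).
  by rewrite !mulr_gt0// subr_gt0.
nra.
Unshelve. all: end_near. Qed.

Lemma continuous_atZ (c : R[i]) g t : continuous_at g t ->
  continuous_at (fun s => c * g s) t.
Proof. by move=> cg; apply: continuous_atM => //; exact: continuous_at_cst. Qed.

Lemma continuous_atB g h t : continuous_at g t -> continuous_at h t ->
  continuous_at (fun s => g s - h s) t.
Proof.
move=> cg ch; apply: continuous_atD => // e e0; near=> s.
by rewrite -opprD normcN; near: s; exact: ch.
Unshelve. all: end_near. Qed.

Lemma continuous_atX g n t : continuous_at g t ->
  continuous_at (fun s => g s ^+ n) t.
Proof.
move=> cg; elim: n => [|n IH]; first exact: continuous_at_cst.
under [X in continuous_at X]eq_fun do rewrite exprS.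
exact: continuous_atM.
Qed.

Lemma continuous_at_comp g (k : R[i]^o -> R[i]) t :
  continuous_at g t -> continuous_at k (g t) ->
  continuous_at (fun s => k (g s)) t.
Proof.
move=> cg ck e e0; have /nearC[d d0 H] := ck _ e0.
by near=> s; apply: H; near: s; exact: cg.
Unshelve. all: end_near. Qed.

Lemma continuous_at_ReIm (a b : T -> R) t :
  {for t, continuous a} -> {for t, continuous b} ->
  continuous_at (fun s => a s +i* b s) t.
Proof.
move=> ca cb e e0; near=> s.
rewrite (le_lt_trans (normc_le_ReIm _))//= (splitr e) ltrD// distrC; near: s.
  by apply: (@cvgr_dist_lt _ _ _ _ _ a (a t) ca); rewrite divr_gt0.
by apply: (@cvgr_dist_lt _ _ _ _ _ b (b t) cb); rewrite divr_gt0.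
Unshelve. all: end_near. Qed.

Lemma continuous_at_Re g t : continuous_at g t ->
  {for t, continuous (fun s => Re (g s))}.
Proof.
move=> cg; apply/cvgrPdist_lt => e e0; near=> s.
rewrite distrC (le_lt_trans (_ : _ <= normc (g s - g t)))//.
  rewrite (le_trans _ (Re_le_normc _))//.
  by case: (g s) (g t) => [? ?] [? ?].
by near: s; exact: cg.
Unshelve. all: end_near. Qed.

Lemma continuous_at_Im g t : continuous_at g t ->
  {for t, continuous (fun s => Im (g s))}.
Proof.
move=> cg; apply/cvgrPdist_lt => e e0; near=> s.
rewrite distrC (le_lt_trans (_ : _ <= normc (g s - g t)))//.
  rewrite (le_trans _ (Im_le_normc _))//.
  by case: (g s) (g t) => [? ?] [? ?].
by near: s; exact: cg.
Unshelve. all: end_near. Qed.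

Lemma continuous_at_normc g t : continuous_at g t ->
  {for t, continuous (fun s => normc (g s))}.
Proof.
move=> cg; apply/cvgrPdist_lt => e e0; near=> s.
have d : normc (g s - g t) < e by near: s; exact: cg.
have := ler_normcB (g s) (g t); have := ler_normcB (g t) (g s).
rewrite (normcB (g t)) => h1 h2.
by rewrite ltr_norml; apply/andP; split; lra.
Unshelve. all: end_near. Qed.

End Domain.

Lemma continuous_at_id (z : R[i]^o) : continuous_at (fun w : R[i]^o => w) z.
Proof. by move=> e e0; apply/nearC; exists e. Qed.

End ContinuousAt.

(** * Complex derivatives *)

Section ComplexDerivative.
Variable R : realType.
Implicit Types (f g : R[i]^o -> R[i]) (p l : R[i]^o).

(** Carathéodory's form of complex differentiability: the increment factors
  through a slope that is continuous at the point. Products and compositions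
  then need no estimates. *)
Definition cderiv f p l := exists q : R[i]^o -> R[i],
  [/\ continuous_at q p, q p = l
    & \forall w \near p, f w - f p = q w * (w - p)].

(** The error form of the derivative, in which the local estimate of Goursat's
  theorem and the comparison with difference quotients are carried out. *)
Lemma cderivP f p l : cderiv f p l <->
  (forall e : R, 0 < e ->
    \forall w \near p, normc (f w - f p - l * (w - p)) <= e * normc (w - p)).
Proof.
split=> [[q [cq <- fq]] e e0|H].
  near=> w.
  have -> : f w - f p = q w * (w - p) by near: w.
  rewrite -mulrBl normcM ler_wpM2r ?normc_ge0// ltW//.
  by near: w; exact: cq.
pose q (w : R[i]^o) : R[i] := if w == p then l else (f w - f p) / (w - p).
exists q; split; last 2 first.
- by rewrite /q eqxx.
- apply/nearC; exists 1 => // w _; rewrite /q; case: eqP => [->|/eqP wp].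
    by rewrite !subrr mulr0.
  by rewrite divfK// subr_eq0.
move=> e e0; near=> w.
rewrite {2}/q eqxx /q; case: eqP => [_|/eqP wp]; first by rewrite subrr normc0.
have wp0 : 0 < normc (w - p) by rewrite normc_gt0 subr_eq0.
rewrite (@le_lt_trans _ _ (e / 2))//; last by rewrite ltr_pdivrMr// ltr_pMr// ltr1n.
rewrite -(ler_pM2r wp0) -normcM mulrBl divfK ?subr_eq0//.
by near: w; apply: H; rewrite divr_gt0.
Unshelve. all: end_near. Qed.

Lemma cderiv_continuous f p l : cderiv f p l -> continuous_at f p.
Proof.
move=> [q [cq _ fq]].
apply: (@continuous_at_near _ _ (fun w => f p + q w * (w - p))).
- by rewrite subrr mulr0 addr0.
- near=> w; have <- : f w - f p = q w * (w - p) by near: w.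
  by rewrite addrC subrK.
apply: continuous_atD; first exact: continuous_at_cst.
apply: continuous_atM => //; apply: continuous_atB.
  exact: continuous_at_id.
exact: continuous_at_cst.
Unshelve. all: end_near. Qed.

Lemma cderiv_near f g p l : f p = g p -> (\forall w \near p, f w = g w) ->
  cderiv f p l -> cderiv g p l.
Proof.
move=> fg fgn [q [cq ql fq]]; exists q; split=> //; near=> w.
have <- : f w = g w by near: w.
by rewrite -fg; near: w.
Unshelve. all: end_near. Qed.

Lemma cderiv_cst (c : R[i]) p : cderiv (fun=> c) p 0.
Proof.
exists (fun=> 0); split=> //; first exact: continuous_at_cst.
by apply/nearC; exists 1 => // w _; rewrite subrr mul0r.
Qed.

Lemma cderiv_id p : cderiv (fun w => w) p 1.
Proof.
exists (fun=> 1); split=> //; first exact: continuous_at_cst.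
by apply/nearC; exists 1 => // w _; rewrite mul1r.
Qed.

Lemma cderivD f g p l k : cderiv f p l -> cderiv g p k ->
  cderiv (fun w => f w + g w) p (l + k).
Proof.
move=> [q [cq <- fq]] [r [cr <- gr]]; exists (fun w => q w + r w); split=> //.
  exact: continuous_atD.
by near=> w; rewrite opprD addrACA mulrDl; congr (_ + _); near: w.
Unshelve. all: end_near. Qed.

Lemma cderivM f g p l k : cderiv f p l -> cderiv g p k ->
  cderiv (fun w => f w * g w) p (l * g p + f p * k).
Proof.
move=> df [r [cr <- gr]]; have cf := cderiv_continuous df.
case: df => [q [cq <- fq]].
exists (fun w => q w * g p + f w * r w); split=> //.
  apply: continuous_atD; apply: continuous_atM => //; exact: continuous_at_cst.
near=> w.
have -> : f w * g w - f p * g p = (f w - f p) * g p + f w * (g w - g p) by ring.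
have -> : f w - f p = q w * (w - p) by near: w.
have -> : g w - g p = r w * (w - p) by near: w.
by ring.
Unshelve. all: end_near. Qed.

Lemma cderivV f p l : f p != 0 -> cderiv f p l ->
  cderiv (fun w => (f w)^-1) p (- l / f p ^+ 2).
Proof.
move=> fp0 df; have cf := cderiv_continuous df.
case: df => [q [cq <- fq]].
exists (fun w => - q w * ((f w)^-1 * (f p)^-1)); split=> //.
- apply: continuous_atM.
    under [X in continuous_at X]eq_fun do rewrite -mulN1r.
    exact: continuous_atZ.
  apply: continuous_atM; last exact: continuous_at_cst.
  exact: continuous_atV.
- by rewrite -expr2 -exprVn.
near=> w.
have fw0 : f w != 0.
  rewrite -normc_gt0.
  have : normc (f w - f p) < normc (f p).
    by near: w; apply: cf; rewrite normc_gt0.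
  have := ler_normcB (f p) (f w); rewrite normcB; lra.
have -> : (f w)^-1 - (f p)^-1 = - (f w - f p) * ((f w)^-1 * (f p)^-1).
  by field; rewrite fw0 fp0.
have -> : f w - f p = q w * (w - p) by near: w.
by ring.
Unshelve. all: end_near. Qed.

Lemma cderiv_comp f g p l k : cderiv f p l -> cderiv g (f p) k ->
  cderiv (fun w => g (f w)) p (k * l).
Proof.
move=> df [r [cr <- gr]]; have cf := cderiv_continuous df.
case: df => [q [cq <- fq]].
exists (fun w => r (f w) * q w); split=> //.
  by apply: continuous_atM => //; exact: continuous_at_comp.
move/nearC : gr => [d d0 gr].
near=> w.
have -> : g (f w) - g (f p) = r (f w) * (f w - f p).
  by apply: gr; near: w; exact: cf.
have -> : f w - f p = q w * (w - p) by near: w.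
by rewrite mulrA.
Unshelve. all: end_near. Qed.

Lemma derivable_cderiv f p : derivable (f : R[i]^o -> R[i]^o) p 1 ->
  exists l, cderiv f p l.
Proof.
move=> /cvg_ex[l /cvgrPdist_lt fl]; exists l; apply/cderivP => e e0.
have ec0 : 0 < e%:C by rewrite ltcR.
have /nearC[d d0 H] := fl _ ec0.
apply/nearC; exists d => // w wd.
have [->|wp] := eqVneq w p; first by rewrite !subrr mulr0 subrr normc0 mulr0.
have wp0 : w - p != 0 by rewrite subr_eq0.
have := H (w - p); rewrite subr0 => /(_ wd wp0).
rewrite /= /GRing.scale /= mulr1 subrK normc_norm ltcR => /ltW h.
have -> : f w - f p - l * (w - p) = - (l - (w - p)^-1 * (f w - f p)) * (w - p).
  by field.
by rewrite normcM normcN ler_wpM2r ?normc_ge0.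
Qed.

Lemma cderiv_derive1 (f : R[i]^o -> R[i]^o) p l : cderiv f p l ->
  derive1 f p = l.
Proof.
move=> /cderivP df; apply: cvg_lim => //; apply/cvgrPdist_lt => e.
case: e => e e'; rewrite ltcE /= => /andP[/eqP -> e0].
have e20 : 0 < e / 2 by rewrite divr_gt0.
have /nearC[d d0 H] := df _ e20.
apply/nearC; exists d => // h; rewrite subr0 => hd h0.
have := H (h + p); rewrite addrK => /(_ hd) {}H.
rewrite normc_norm ltcR /GRing.scale /=.
have -> : l - h^-1 * (f (h + p) - f p) = - (f (h + p) - f p - l * h) * h^-1.
  by field.
rewrite normcM normcN normcV ltr_pdivrMr ?normc_gt0// (le_lt_trans H)//.
rewrite ltr_pM2r ?normc_gt0//; lra.
Qed.

End ComplexDerivative.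

(** * The complex exponential and circles *)

Section ComplexExponential.
Variable R : realType.
Implicit Types (z w : R[i]).

Lemma expC0 : expC 0 = 1 :> R[i].
Proof. by rewrite /expC /= expR0 cos0 sin0 mul1r. Qed.

Lemma expCD z w : expC (z + w) = expC z * expC w.
Proof.
case: z w => [a b] [c d]; rewrite /expC /= expRD cosD sinD; simpc.
by congr (_ +i* _); ring.
Qed.

Lemma normc_expC z : normc (expC z) = expR (Re z).
Proof.
rewrite /expC normcM normc_real ger0_norm ?expR_ge0//=.
by rewrite cos2Dsin2 sqrtr1 mulr1.
Qed.

Lemma is_derive_little_o (f : R -> R) (x l : R) : is_derive x 1 f l ->
  forall e, 0 < e -> exists2 d, 0 < d & forall h, `|h| < d ->
    `|f (h + x) - f x - l * h| <= e * `|h|.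
Proof.
move=> [fx <-] e e0.
have /cvgrPdist_lt/(_ _ e0) /nbhs_norm0P[d /= d0 H] := fx.
exists d => // h hd.
have [->|h0] := eqVneq h 0; first by rewrite add0r subrr sub0r mulr0 oppr0 normr0 mulr0.
have := H h; rewrite /= => /(_ hd h0).
rewrite /GRing.scale /= mulr1 => /ltW {}H.
set D := lim _ in H.
have -> : f (h + x) - f x - 'D_1 f x * h = - (D - h^-1 * (f (h + x) - f x)) * h.
  by rewrite /D /derive; field.
by rewrite normrM normrN ler_wpM2r.
Qed.

(** The first-order expansions of the real exponential, cosine and sine
  combine, since the error is e^x (cos y - 1) + (e^x - 1 - x) in the real part and
  e^x (sin y - y) + (e^x - 1) y in the imaginary part. *)
Lemma cderiv_expC0 : cderiv (@expC R) 0 1.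
Proof.
apply/cderivP => e e0; apply/nearC.
(* the four error terms below cost at most 3/16, 1/16, 3/16 and 2/16 of [e] *)
have d0 : 0 < Num.min 1 (e / 16) by rewrite lt_min ltr01 divr_gt0.
have [d1 d10 H1] := is_derive_little_o (is_derive_expR (0 : R)) d0.
have [d2 d20 H2] := is_derive_little_o (is_derive_cos (0 : R)) d0.
have [d3 d30 H3] := is_derive_little_o (is_derive_sin (0 : R)) d0.
exists (Num.min (Num.min d1 (Num.min d2 d3)) (Num.min 1 (e / 16))).
  by rewrite !lt_min d10 d20 d30 -lt_min.
move=> z; rewrite subr0 mul1r expC0 lt_min => /andP[].
rewrite !lt_min => /and3P[z1 z2 z3] /andP[z4 z5].
have R0 := normc_ge0 z.
have Rz := Re_le_normc z; have Iz := Im_le_normc z.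
have {H1}h1 := H1 _ (le_lt_trans Rz z1).
have {H2}h2 := H2 _ (le_lt_trans Iz z2).
have {H3}h3 := H3 _ (le_lt_trans Iz z3).
rewrite addr0 expR0 mul1r in h1.
rewrite addr0 cos0 sin0 oppr0 mul0r subr0 in h2.
rewrite addr0 cos0 sin0 subr0 mul1r in h3.
have -> : expC z - 1 - z = (expR (Re z) * (cos (Im z) - 1) + (expR (Re z) - 1 - Re z)) +i*
   (expR (Re z) * (sin (Im z) - Im z) + (expR (Re z) - 1) * Im z).
  by case: (z) => x y; rewrite /expC /=; simpc; congr (_ +i* _); ring.
move: (normc z) (Re z) (Im z) z4 z5 R0 Rz Iz h1 h2 h3.
move=> N x y z4 z5 R0 Rz Iz.
have [m1 m2] : Num.min 1 (e / 16) <= 1 /\ Num.min 1 (e / 16) <= e / 16.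
  by rewrite !ge_min !lexx/= orbT.
set m := Num.min 1 (e / 16) in d0 m1 m2 * => h1 h2 h3.
have k1 : `|expR x - 1 - x| <= e / 16 * N.
  by rewrite (le_trans h1)// ler_pM// ltW.
have k2 : `|cos y - 1| <= e / 16 * N.
  by rewrite (le_trans h2)// ler_pM// ltW.
have k3 : `|sin y - y| <= e / 16 * N.
  by rewrite (le_trans h3)// ler_pM// ltW.
have k4 : `|expR x - 1| <= 2 * N.
  rewrite -(subrK x (expR x - 1)) (le_trans (ler_normD _ _))//.
  rewrite (le_trans (lerD h1 Rz))//.
  have : m * `|x| <= 1 * N by rewrite ler_pM// ltW.
  lra.
have k5 : expR x <= 3 by move: k4; rewrite ler_norml => /andP[_ ?]; lra.
have k6 := expR_gt0 x.
rewrite (le_trans (normc_le_ReIm _))//=.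
rewrite (le_trans (lerD (ler_normD _ _) (ler_normD _ _)))//.
rewrite !normrM (gtr0_norm k6).
have j1 : expR x * `|cos y - 1| <= 3 * (e / 16 * N).
  by rewrite ler_pM// ltW.
have j2 : expR x * `|sin y - y| <= 3 * (e / 16 * N).
  by rewrite ler_pM// ltW.
have j3 : `|expR x - 1| * `|y| <= 2 * N * N by rewrite ler_pM.
have j4 : 2 * N * N <= 2 * (e / 16) * N.
  by rewrite ler_wpM2r// ler_wpM2l// ltW.
have j5 := mulr_ge0 (ltW e0) R0.
lra.
Qed.

(** The addition formula transports the derivative from the origin. *)
Lemma cderiv_expC z : cderiv (@expC R) z (expC z).
Proof.
have -> : @expC R = fun w => expC z * expC (w - z).
  by apply/funext => w; rewrite -expCD addrC subrK.
have hz : cderiv (fun w : R[i]^o => w - z) z (1 + 0).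
  by apply: cderivD; [exact: cderiv_id|exact: cderiv_cst].
have h0 : cderiv (@expC R) (z - z) 1 by rewrite subrr; exact: cderiv_expC0.
have := cderivM (cderiv_cst (expC z) z) (cderiv_comp hz h0).
by rewrite subrr expC0 mul0r add0r addr0 !mulr1.
Qed.

(** The circle of radius [r] about the origin, run through once as [t] runs
  over the unit interval. *)
Definition circ (r t : R) : R[i] :=
  (r * cos (2 * pi * t)) +i* (r * sin (2 * pi * t)).

(** The exponential wraps each vertical segment of unit length, after scaling,
  exactly once around a circle. *)
Lemma expC_circ (x t : R) :
  expC ((2 * pi)%:C * (x +i* t)) = circ (expR (2 * pi * x)) t.
Proof. by rewrite /expC /circ; simpc. Qed.

Lemma normc_circ r t : 0 <= r -> normc (circ r t) = r.
Proof.
move=> r0; have -> : circ r t = r%:C * (cos (2 * pi * t) +i* sin (2 * pi * t)).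
  by rewrite /circ; simpc.
by rewrite normcM normc_real ger0_norm//= cos2Dsin2 sqrtr1 mulr1.
Qed.

Lemma circ_periodic r : circ r 1 = circ r 0.
Proof.
rewrite /circ !mulr1 !mulr0 cos0 sin0.
by rewrite -[2 * pi]add0r -mulr_natl !mulr_natl cosD2pi sinD2pi cos0 sin0.
Qed.

Lemma circ_neq0 r t : 0 < r -> circ r t != 0.
Proof. by move=> r0; rewrite -normc_gt0 normc_circ// ltW. Qed.

Lemma continuous_circ r t : continuous_at (circ r) t.
Proof.
have ct : {for t, continuous (fun s : R => 2 * pi * s)}.
  exact: (@mulrl_continuous R).
apply: continuous_at_ReIm.
- apply: (@continuousM R R); first exact: cst_continuous.
  by apply: (@continuous_comp R R R (fun s => 2 * pi * s) cos) => //; exact: continuous_cos.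
- apply: (@continuousM R R); first exact: cst_continuous.
  by apply: (@continuous_comp R R R (fun s => 2 * pi * s) sin) => //; exact: continuous_sin.
Qed.

End ComplexExponential.

(** * Integrals of complex-valued functions on an interval *)

Section ComplexIntegral.
Variable R : realType.
Implicit Types (a b c : R) (phi psi : R -> R[i]).
Local Notation mu := (@lebesgue_measure R).

Definition cint a b phi : R[i] :=
  (\int[mu]_(t in `[a, b]) Re (phi t)) +i* (\int[mu]_(t in `[a, b]) Im (phi t)).

Definition continuous_on_itv a b phi := forall t, a <= t <= b -> continuous_at phi t.

Lemma integrable_Re a b phi : continuous_on_itv a b phi ->
  mu.-integrable `[a, b] (EFin \o (fun t => Re (phi t))).
Proof.
move=> cphi; apply: continuous_compact_integrable; first exact: segment_compact.
apply: continuous_in_subspaceT => t; rewrite inE/= in_itv/= => tab.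
exact: continuous_at_Re (cphi _ tab).
Qed.

Lemma integrable_Im a b phi : continuous_on_itv a b phi ->
  mu.-integrable `[a, b] (EFin \o (fun t => Im (phi t))).
Proof.
move=> cphi; apply: continuous_compact_integrable; first exact: segment_compact.
apply: continuous_in_subspaceT => t; rewrite inE/= in_itv/= => tab.
exact: continuous_at_Im (cphi _ tab).
Qed.

Lemma eq_cint a b phi psi : (forall t, a <= t <= b -> phi t = psi t) ->
  cint a b phi = cint a b psi.
Proof.
move=> e; rewrite /cint; congr (_ +i* _); apply: eq_Rintegral => t;
  by rewrite inE/= in_itv/= => tab; rewrite e.
Qed.

Lemma cintD a b phi psi :
  continuous_on_itv a b phi -> continuous_on_itv a b psi ->
  cint a b (fun t => phi t + psi t) = cint a b phi + cint a b psi.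
Proof.
move=> cphi cpsi; rewrite /cint; simpc; congr (_ +i* _).
  rewrite -RintegralD//; [|exact: integrable_Re..].
  by apply: eq_Rintegral => t _; case: (phi t) (psi t) => [? ?] [? ?].
rewrite -RintegralD//; [|exact: integrable_Im..].
by apply: eq_Rintegral => t _; case: (phi t) (psi t) => [? ?] [? ?].
Qed.

Lemma cintZ a b (k : R[i]) phi : continuous_on_itv a b phi ->
  cint a b (fun t => k * phi t) = k * cint a b phi.
Proof.
move=> cphi; have iRe := integrable_Re cphi; have iIm := integrable_Im cphi.
have mI : measurable (`[a, b]%classic : set (measurableTypeR R)) by [].
case: k => x y; rewrite /cint; simpc; congr (_ +i* _).
  rewrite -!RintegralZl// -RintegralB//; last 2 first.
  - by apply: (integrableZl mI x iRe).
  - by apply: (integrableZl mI y iIm).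
  by apply: eq_Rintegral => t _; case: (phi t) => [? ?]; simpc.
rewrite -!RintegralZl// -RintegralD//; last 2 first.
- by apply: (integrableZl mI x iIm).
- by apply: (integrableZl mI y iRe).
by apply: eq_Rintegral => t _; case: (phi t) => [? ?]; simpc.
Qed.

Lemma cintB a b phi psi :
  continuous_on_itv a b phi -> continuous_on_itv a b psi ->
  cint a b (fun t => phi t - psi t) = cint a b phi - cint a b psi.
Proof.
move=> cphi cpsi; rewrite -[- cint a b psi]mulN1r -cintZ// -cintD//.
  by apply: eq_cint => t _; rewrite mulN1r.
by move=> t tab; apply: continuous_atZ; exact: cpsi.
Qed.

Lemma cint_cst a b (k : R[i]) : a <= b ->
  cint a b (fun=> k) = (b - a)%:C * k.
Proof.
move=> ab; case: k => x y; rewrite /cint /= !Rintegral_cst//.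
have -> : fine (mu `[a, b]) = b - a.
  by rewrite lebesgue_measure_itv/= lte_fin; case: ltgtP ab => //= -> _; rewrite subrr.
by simpc; rewrite ![(b - a) * _]mulrC.
Qed.

Lemma cint_cat a b c phi : a <= b -> b <= c -> continuous_on_itv a c phi ->
  cint a c phi = cint a b phi + cint b c phi.
Proof.
move=> ab bc cphi; have iRe := integrable_Re cphi; have iIm := integrable_Im cphi.
have sub : `[b, c] `<=` `[a, c].
  by move=> t /=; rewrite !in_itv/= => /andP[bt ->]; rewrite (le_trans ab).
rewrite /cint; simpc; congr (_ +i* _); apply/eqP; rewrite addrC -subr_eq; apply/eqP.
  rewrite Rintegral_itvB ?bnd_simp//.
  apply: Rintegral_itv_obnd_cbnd.
  apply: integrableS iRe => // t /=; rewrite !in_itv/= => /andP[bt ->].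
  by rewrite (le_trans ab)// ltW.
rewrite Rintegral_itvB ?bnd_simp//.
apply: Rintegral_itv_obnd_cbnd.
apply: integrableS iIm => // t /=; rewrite !in_itv/= => /andP[bt ->].
by rewrite (le_trans ab)// ltW.
Qed.

(** The factor two pays for bounding real and imaginary part separately. *)
Lemma normc_cint_le a b phi (M : R) : a <= b -> continuous_on_itv a b phi ->
  (forall t, a <= t <= b -> normc (phi t) <= M) ->
  normc (cint a b phi) <= 2 * M * (b - a).
Proof.
move=> ab cphi phiM.
have mI : measurable (`[a, b]%classic : set (measurableTypeR R)) by [].
have iM : mu.-integrable `[a, b] (EFin \o cst M).
  apply: continuous_compact_integrable; first exact: segment_compact.
  by apply: continuous_subspaceT; exact: cst_continuous.
have fI : fine (mu `[a, b]) = b - a.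
  by rewrite lebesgue_measure_itv/= lte_fin; case: ltgtP ab => //= -> _; rewrite subrr.
have bnd (u : R -> R) : mu.-integrable `[a, b] (EFin \o u) ->
    (forall t, a <= t <= b -> `|u t| <= M) ->
    `|\int[mu]_(t in `[a, b]) u t| <= M * (b - a).
  move=> iu uM; rewrite (le_trans (le_normr_Rintegral _ _))//.
  rewrite -fI -(Rintegral_cst mu mI M); apply: le_Rintegral => //.
    exact: (integrable_norm iu).
rewrite (le_trans (normc_le_ReIm _))//= -mulrA mulr2n mulrDl mul1r lerD//.
  apply: bnd; first exact: integrable_Re.
  by move=> t tab; rewrite (le_trans (Re_le_normc _))// phiM.
apply: bnd; first exact: integrable_Im.
by move=> t tab; rewrite (le_trans (Im_le_normc _))// phiM.
Qed.

End ComplexIntegral.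

(** * Goursat's theorem for rectangles *)

Section Bisection.
Variable R : realType.
Implicit Types (x y u v s : R).

(** A property that passes from the four quarters of a rectangle to the
  rectangle, and holds for all small rectangles around each point, holds
  globally: otherwise it fails for one quarter, then for a quarter of that quarter,
  and so on, and these rectangles shrink to a point where it holds locally. The
  rectangles are given by their lower left corner and the ratio [s] of
  their sides to [a] and [b]. *)
Lemma quarter_induction (P : R -> R -> R -> Prop) (a b x y : R) :
  0 <= a -> 0 <= b ->
  (forall u v s, 0 < s -> P u v (s / 2) -> P (u + s / 2 * a) v (s / 2) ->
     P u (v + s / 2 * b) (s / 2) -> P (u + s / 2 * a) (v + s / 2 * b) (s / 2) ->
     P u v s) ->
  (forall u v, x <= u <= x + a -> y <= v <= y + b ->
     exists2 d, 0 < d & forall u' v' s, 0 < s < d ->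
       x <= u' -> u' + s * a <= x + a -> y <= v' -> v' + s * b <= y + b ->
       u' <= u <= u' + s * a -> v' <= v <= v' + s * b -> P u' v' s) ->
  P x y 1.
Proof.
move=> a0 b0 Pstep Ploc; apply: contrapT => nP.
have half n : (2^-1 : R) ^+ n.+1 = 2^-1 ^+ n / 2 by rewrite exprSr.
have hgt0 n : 0 < (2^-1 : R) ^+ n by rewrite exprn_gt0// invr_gt0.
pose step n (p p' : R * R) := ~ P p.1 p.2 (2^-1 ^+ n) ->
  [/\ ~ P p'.1 p'.2 (2^-1 ^+ n.+1), p.1 <= p'.1 <= p.1 + 2^-1 ^+ n.+1 * a
    & p.2 <= p'.2 <= p.2 + 2^-1 ^+ n.+1 * b].
have [next nextP] : {next : nat * (R * R) -> R * R &
    forall np, step np.1 np.2 (next np)}.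
  apply: (choice (P := fun np => step np.1 np.2)) => -[n [u v]]; rewrite /step /= half.
  have h0 : 0 <= 2^-1 ^+ n / 2 :> R by rewrite divr_ge0// ltW.
  have ha := mulr_ge0 h0 a0; have hb := mulr_ge0 h0 b0.
  have [?|n1] := pselect (P u v (2^-1 ^+ n / 2)); last first.
    by exists (u, v) => _; rewrite /= !lexx !lerDl ?andbT.
  have [?|n2] := pselect (P (u + 2^-1 ^+ n / 2 * a) v (2^-1 ^+ n / 2)); last first.
    by exists (u + 2^-1 ^+ n / 2 * a, v) => _; rewrite /= !lexx !lerDl ?andbT.
  have [?|n3] := pselect (P u (v + 2^-1 ^+ n / 2 * b) (2^-1 ^+ n / 2)); last first.
    by exists (u, v + 2^-1 ^+ n / 2 * b) => _; rewrite /= !lexx !lerDl ?andbT.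
  have [?|n4] := pselect (P (u + 2^-1 ^+ n / 2 * a) (v + 2^-1 ^+ n / 2 * b) (2^-1 ^+ n / 2)); last first.
    by exists (u + 2^-1 ^+ n / 2 * a, v + 2^-1 ^+ n / 2 * b) => _; rewrite /= !lexx !lerDl ?andbT.
  by exists (u, v) => nPn; exfalso; apply: nPn; exact: Pstep.
pose z := fix z n := if n is m.+1 then next (m, z m) else (x, y).
have zP n : ~ P (z n).1 (z n).2 (2^-1 ^+ n).
  by elim: n => [|n IH]; [rewrite expr0|have [] := nextP (n, z n) IH].
have zS n := nextP (n, z n) (zP n).
(* the corners increase and stay bounded; the limit lies in all rectangles *)
have mono (c : R) (w : nat -> R) : 0 <= c ->
    (forall n, w n <= w n.+1 <= w n + 2^-1 ^+ n.+1 * c) ->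
    exists2 u, w 0%N <= u <= w 0%N + c & forall n,
      [/\ w n <= u <= w n + 2^-1 ^+ n * c, w 0%N <= w n
        & w n + 2^-1 ^+ n * c <= w 0%N + c].
  move=> c0 wS.
  have wD n k : w n <= w (n + k)%N /\ w (n + k)%N + 2^-1 ^+ (n + k) * c <= w n + 2^-1 ^+ n * c.
    elim: k => [|k [IH1 IH2]]; first by rewrite addn0.
    have /andP[h1 h2] := wS (n + k)%N; rewrite addnS; split.
      exact: le_trans h1.
    by move: IH2 h2; rewrite half; lra.
  have wub n m : w m <= w n + 2^-1 ^+ n * c.
    have hc k : 0 <= 2^-1 ^+ k * c by rewrite mulr_ge0// ltW.
    have [mn|/ltnW nm] := leqP m n.
      have [] := wD m (n - m)%N; rewrite subnKC// => h _.
      by rewrite (le_trans h)// lerDl.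
    have [_] := wD n (m - n)%N; rewrite subnKC// => h.
    by rewrite (le_trans _ h)// lerDl.
  have ubw n : ubound (range w) (w n + 2^-1 ^+ n * c).
    by move=> _ [m _ <-]; exact: wub.
  have uP n : w n <= sup (range w) <= w n + 2^-1 ^+ n * c.
    rewrite ge_sup// ?andbT//; last by exists (w 0%N); exists 0%N.
    by apply: ub_le_sup; [exists (w n + 2^-1 ^+ n * c)|exists n].
  exists (sup (range w)); first by have := uP 0%N; rewrite expr0 mul1r.
  move=> n; have [] := wD 0%N n; rewrite add0n expr0 mul1r => h1 h2.
  by split.
have [u u01 uP] : exists2 u, (z 0%N).1 <= u <= (z 0%N).1 + a & forall n,
    [/\ (z n).1 <= u <= (z n).1 + 2^-1 ^+ n * a, (z 0%N).1 <= (z n).1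
      & (z n).1 + 2^-1 ^+ n * a <= (z 0%N).1 + a].
  by apply: mono => // n; have [] := zS n.
have [v v01 vP] : exists2 u, (z 0%N).2 <= u <= (z 0%N).2 + b & forall n,
    [/\ (z n).2 <= u <= (z n).2 + 2^-1 ^+ n * b, (z 0%N).2 <= (z n).2
      & (z n).2 + 2^-1 ^+ n * b <= (z 0%N).2 + b].
  by apply: mono => // n; have [] := zS n.
have [d d0 dP] := Ploc u v u01 v01.
have [n nd] : exists n, 2^-1 ^+ n < d.
  have h1 : `|2^-1 : R| < 1 by rewrite ger0_norm ?invr_ge0// invf_lt1// ltr1n.
  have /cvgrPdist_lt/(_ _ d0)[n _ /(_ n (leqnn n))] := cvg_expr h1.
  by rewrite /= sub0r normrN ger0_norm ?ltW//; exists n.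
apply: (zP n); have [? ? ?] := uP n; have [? ? ?] := vP n.
by apply: dP => //; rewrite hgt0.
Qed.

End Bisection.

Section Goursat.
Variable R : realType.
Implicit Types (g : R[i]^o -> R[i]).

(** The contour integral along the boundary of a rectangle. Opposite sides share
  one integral, so that for an affine function both integrands are constant. *)
Definition rect_int g (x1 x2 y1 y2 : R) : R[i] :=
  cint x1 x2 (fun t => g (t +i* y1) - g (t +i* y2)) +
  'i%C * cint y1 y2 (fun t => g (x2 +i* t) - g (x1 +i* t)).

Definition continuous_on_rect g (x1 x2 y1 y2 : R) := forall x y,
  x1 <= x <= x2 -> y1 <= y <= y2 -> continuous_at g (x +i* y).

Lemma continuous_horizontal (y t : R) :
  continuous_at (fun s : R => s +i* y) t.
Proof. by apply: continuous_at_ReIm; [exact: id|exact: cst_continuous]. Qed.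

Lemma continuous_vertical (x t : R) :
  continuous_at (fun s : R => x +i* s) t.
Proof. by apply: continuous_at_ReIm; [exact: cst_continuous|exact: id]. Qed.

Lemma continuous_on_horizontal g (x1 x2 y1 y2 y : R) :
  continuous_on_rect g x1 x2 y1 y2 -> y1 <= y <= y2 ->
  continuous_on_itv x1 x2 (fun t => g (t +i* y)).
Proof.
move=> cg yy t tx; apply: continuous_at_comp; first exact: continuous_horizontal.
exact: cg.
Qed.

Lemma continuous_on_vertical g (x1 x2 y1 y2 x : R) :
  continuous_on_rect g x1 x2 y1 y2 -> x1 <= x <= x2 ->
  continuous_on_itv y1 y2 (fun t => g (x +i* t)).
Proof.
move=> cg xx t ty; apply: continuous_at_comp; first exact: continuous_vertical.
exact: cg.
Qed.

Lemma continuous_on_itvB (a b : R) phi psi : continuous_on_itv a b phi ->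
  continuous_on_itv a b psi -> continuous_on_itv a b (fun t => phi t - psi t).
Proof.
by move=> cphi cpsi t tab; apply: continuous_atB; [exact: cphi|exact: cpsi].
Qed.

Lemma continuous_on_rectS g (x1 x2 y1 y2 x1' x2' y1' y2' : R) :
  x1 <= x1' -> x2' <= x2 -> y1 <= y1' -> y2' <= y2 ->
  continuous_on_rect g x1 x2 y1 y2 -> continuous_on_rect g x1' x2' y1' y2'.
Proof.
move=> a b c d cg x y /andP[e f] /andP[h k]; apply: cg.
  by rewrite (le_trans a)//= (le_trans f).
by rewrite (le_trans c)//= (le_trans k).
Qed.

Lemma rect_int_quarters g (x1 x x2 y1 y y2 : R) :
  x1 <= x -> x <= x2 -> y1 <= y -> y <= y2 ->
  continuous_on_rect g x1 x2 y1 y2 ->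
  rect_int g x1 x2 y1 y2 =
    rect_int g x1 x y1 y + rect_int g x x2 y1 y +
    rect_int g x1 x y y2 + rect_int g x x2 y y2.
Proof.
move=> x1x xx2 y1y yy2 cg.
have x12 := le_trans x1x xx2; have y12 := le_trans y1y yy2.
have H v : y1 <= v <= y2 -> forall u1 u2, x1 <= u1 -> u2 <= x2 ->
    continuous_on_itv u1 u2 (fun t => g (t +i* v)).
  move=> vy u1 u2 h1 h2; apply: (@continuous_on_horizontal g u1 u2 y1 y2) => //.
  exact: continuous_on_rectS cg.
have V u : x1 <= u <= x2 -> forall v1 v2, y1 <= v1 -> v2 <= y2 ->
    continuous_on_itv v1 v2 (fun t => g (u +i* t)).
  move=> ux v1 v2 h1 h2; apply: (@continuous_on_vertical g x1 x2 v1 v2) => //.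
  exact: continuous_on_rectS cg.
have b1 : x1 <= x1 <= x2 by rewrite lexx.
have b2 : x1 <= x2 <= x2 by rewrite lexx x12.
have b : x1 <= x <= x2 by rewrite x1x.
have c1 : y1 <= y1 <= y2 by rewrite lexx.
have c2 : y1 <= y2 <= y2 by rewrite lexx y12.
have c : y1 <= y <= y2 by rewrite y1y.
rewrite /rect_int !cintB; do ?[exact: H | exact: V].
rewrite (cint_cat x1x xx2 (H _ c1 _ _ (lexx _) (lexx _))).
rewrite (cint_cat x1x xx2 (H _ c2 _ _ (lexx _) (lexx _))).
rewrite (cint_cat y1y yy2 (V _ b1 _ _ (lexx _) (lexx _))).
rewrite (cint_cat y1y yy2 (V _ b2 _ _ (lexx _) (lexx _))).
by ring.
Qed.

(** The contour integral of an affine function vanishes, so only the error of the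
  linear approximation contributes; on a rectangle of diameter at most [D] it is at
  most [e * D], and the perimeter is at most [2 * D]. *)
Lemma rect_int_small g (p l : R[i]) (x1 x2 y1 y2 e D : R) :
  x1 <= x2 -> y1 <= y2 -> 0 <= e -> (x2 - x1) + (y2 - y1) <= D ->
  x1 <= Re p <= x2 -> y1 <= Im p <= y2 ->
  continuous_on_rect g x1 x2 y1 y2 ->
  (forall x y, x1 <= x <= x2 -> y1 <= y <= y2 ->
    normc (g (x +i* y) - g p - l * (x +i* y - p)) <= e * normc (x +i* y - p)) ->
  normc (rect_int g x1 x2 y1 y2) <= 4 * e * D ^+ 2.
Proof.
move=> x12 y12 e0 DD px py cg gE.
pose h (z : R[i]^o) : R[i] := g z - g p - l * (z - p).
have ch : continuous_on_rect h x1 x2 y1 y2.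
  move=> x y xx yy; apply: continuous_atB.
    by apply: continuous_atB; [exact: cg|exact: continuous_at_cst].
  apply: continuous_atZ; apply: continuous_atB; last exact: continuous_at_cst.
  exact: continuous_at_id.
have hE x y : x1 <= x <= x2 -> y1 <= y <= y2 -> normc (h (x +i* y)) <= e * D.
  move=> xx yy; rewrite (le_trans (gE _ _ xx yy))// ler_wpM2l//.
  rewrite (le_trans (normc_le_ReIm _))// (le_trans _ DD)//.
  case: (p) px py => [u v] /= /andP[? ?] /andP[? ?].
  move: xx yy => /andP[? ?] /andP[? ?].
  by apply: lerD; rewrite ler_norml; apply/andP; split; lra.
have b1 : x1 <= x1 <= x2 by rewrite lexx.
have b2 : x1 <= x2 <= x2 by rewrite lexx x12.
have c1 : y1 <= y1 <= y2 by rewrite lexx.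
have c2 : y1 <= y2 <= y2 by rewrite lexx y12.
have Hh v (vy : y1 <= v <= y2) := continuous_on_horizontal ch vy.
have Vh u (ux : x1 <= u <= x2) := continuous_on_vertical ch ux.
have cB := continuous_on_itvB.
have rE : rect_int g x1 x2 y1 y2 = rect_int h x1 x2 y1 y2.
  have ccst u v (k : R[i]) : continuous_on_itv u v (fun=> k).
    by move=> t _; exact: continuous_at_cst.
  have E1 : cint x1 x2 (fun t => g (t +i* y1) - g (t +i* y2)) =
      cint x1 x2 (fun t => h (t +i* y1) - h (t +i* y2)) +
      (x2 - x1)%:C * (l * (0 +i* (y1 - y2))).
    rewrite -cint_cst// -cintD//; last by apply: cB; exact: Hh.
    apply: eq_cint => t _.
    have -> : 0 +i* (y1 - y2) = (t +i* y1) - (t +i* y2) :> R[i].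
      by simpc; congr (_ +i* _); ring.
    by rewrite /h; ring.
  have E2 : cint y1 y2 (fun t => g (x2 +i* t) - g (x1 +i* t)) =
      cint y1 y2 (fun t => h (x2 +i* t) - h (x1 +i* t)) +
      (y2 - y1)%:C * (l * ((x2 - x1) +i* 0)).
    rewrite -cint_cst// -cintD//; last by apply: cB; exact: Vh.
    apply: eq_cint => t _.
    have -> : (x2 - x1) +i* 0 = (x2 +i* t) - (x1 +i* t) :> R[i].
      by simpc; congr (_ +i* _); ring.
    by rewrite /h; ring.
  rewrite /rect_int E1 E2.
  set A := cint x1 x2 _; set B := cint y1 y2 _.
  transitivity (A + 'i%C * B + l * ((x2 - x1)%:C * (0 +i* (y1 - y2)) +
    'i%C * ((y2 - y1)%:C * ((x2 - x1) +i* 0)))); first by ring.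
  rewrite [X in l * X](_ : _ = 0) ?mulr0 ?addr0//.
  by simpc; apply/eqP; rewrite eq_complex /=; apply/andP; split => //; apply/eqP; ring.
have eD : 0 <= e * D.
  by apply: le_trans (hE x1 y1 b1 c1); rewrite normc_ge0.
rewrite rE (le_trans (le_normcD _ _))// normcM normc_i mul1r.
have k1 : normc (cint x1 x2 (fun t => h (t +i* y1) - h (t +i* y2))) <=
    2 * (2 * (e * D)) * (x2 - x1).
  apply: normc_cint_le => //; first by apply: cB; exact: Hh.
  move=> t tx; rewrite (le_trans (le_normcD _ _))// normcN mulrDl mul1r.
  by apply: lerD; exact: hE.
have k2 : normc (cint y1 y2 (fun t => h (x2 +i* t) - h (x1 +i* t))) <=
    2 * (2 * (e * D)) * (y2 - y1).
  apply: normc_cint_le => //; first by apply: cB; exact: Vh.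
  move=> t ty; rewrite (le_trans (le_normcD _ _))// normcN mulrDl mul1r.
  by apply: lerD; exact: hE.
rewrite (le_trans (lerD k1 k2))// -mulrDr.
have -> : 4 * e * D ^+ 2 = 2 * (2 * (e * D)) * D by ring.
by rewrite ler_wpM2l// mulr_ge0// mulr_ge0.
Qed.

(** A bound of the contour integral by [e] times [s ^+ 2] is additive under
  quartering, and differentiability gives it on small rectangles around each
  point; hence it holds for every positive [e]. *)
Lemma goursat_rectangle g (x1 x2 y1 y2 : R) : x1 <= x2 -> y1 <= y2 ->
  (forall x y, x1 <= x <= x2 -> y1 <= y <= y2 ->
    exists l, cderiv g (x +i* y) l) ->
  rect_int g x1 x2 y1 y2 = 0.
Proof.
move=> x12 y12 dg.
have cg : continuous_on_rect g x1 x2 y1 y2.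
  by move=> x y xx yy; have [l /cderiv_continuous] := dg _ _ xx yy.
pose a := x2 - x1; pose b := y2 - y1.
have a0 : 0 <= a by rewrite subr_ge0.
have b0 : 0 <= b by rewrite subr_ge0.
have xa : x1 + a = x2 by rewrite addrC subrK.
have yb : y1 + b = y2 by rewrite addrC subrK.
clearbody a b.
apply: normc_small_eq0 => e e0.
have := @quarter_induction R (fun u v s =>
  x1 <= u -> u + s * a <= x2 -> y1 <= v -> v + s * b <= y2 ->
  normc (rect_int g u (u + s * a) v (v + s * b)) <= e * s ^+ 2) a b x1 y1 a0 b0.
rewrite !mul1r xa yb expr1n mulr1; apply => //.
  move=> u v s s0 P1 P2 P3 P4 ux ux2 vy vy2.
  have s20 : 0 <= s / 2 by rewrite divr_ge0// ltW.
  have sa := mulr_ge0 s20 a0; have sb := mulr_ge0 s20 b0.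
  have sha : u + s / 2 * a + s / 2 * a = u + s * a by rewrite [in RHS](splitr s); ring.
  have shb : v + s / 2 * b + s / 2 * b = v + s * b by rewrite [in RHS](splitr s); ring.
  rewrite !sha !shb in P1 P2 P3 P4.
  rewrite (@rect_int_quarters _ u (u + s / 2 * a) _ v (v + s / 2 * b)) ?lerDl//.
  - rewrite (le_trans (le_normcD _ _))// (le_trans (lerD (le_normcD _ _) (lexx _)))//.
    rewrite (le_trans (lerD (lerD (le_normcD _ _) (lexx _)) (lexx _)))//.
    have -> : e * s ^+ 2 = e * (s / 2) ^+ 2 + e * (s / 2) ^+ 2 +
      e * (s / 2) ^+ 2 + e * (s / 2) ^+ 2 by field.
    have h1 : u + s / 2 * a <= x2 by rewrite (le_trans _ ux2)// -sha lerDl.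
    have h2 : v + s / 2 * b <= y2 by rewrite (le_trans _ vy2)// -shb lerDl.
    have h3 : x1 <= u + s / 2 * a by rewrite (le_trans ux)// lerDl.
    have h4 : y1 <= v + s / 2 * b by rewrite (le_trans vy)// lerDl.
    by do !apply: lerD; [exact: P1|exact: P2|exact: P3|exact: P4].
  - by rewrite -sha lerDl.
  - by rewrite -shb lerDl.
  - exact: continuous_on_rectS cg.
move=> u v ux vy.
have [l /cderivP dl] := dg u v ux vy.
have k0 : 0 < 4 * ((a + b) ^+ 2 + 1) by rewrite mulr_gt0// ltr_wpDl// sqr_ge0.
have e'0 : 0 < e / (4 * ((a + b) ^+ 2 + 1)) by rewrite divr_gt0.
have /nearC[d d0 gd] := dl _ e'0.
have ab1 : 0 < a + b + 1 by rewrite ltr_wpDl// addr_ge0.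
exists (d / (a + b + 1)); first by rewrite divr_gt0.
move=> u' v' s /andP[s0 sd] xu' ux' yv' vy' uu' vv' _ _ _ _.
have sa : 0 <= s * a by rewrite mulr_ge0// ltW.
have sb : 0 <= s * b by rewrite mulr_ge0// ltW.
have := @rect_int_small g (u +i* v) l u' (u' + s * a) v' (v' + s * b)
  (e / (4 * ((a + b) ^+ 2 + 1))) (s * (a + b)).
move=> /(_ _ _ (ltW e'0)) H.
apply: le_trans (H _ _ _ _ _ _ _) _ => //.
- by rewrite lerDl.
- by rewrite lerDl.
- by rewrite mulrDr ![_ + s * _ - _]addrAC !subrr !add0r.
- exact: continuous_on_rectS cg.
- move=> x y xx yy; apply: gd.
  rewrite (le_lt_trans (normc_le_ReIm _))//=.
  have : s * (a + b + 1) < d by rewrite -ltr_pdivlMr.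
  move: uu' vv' xx yy => /andP[? ?] /andP[? ?] /andP[? ?] /andP[? ?].
  apply: le_lt_trans; rewrite !mulrDr mulr1.
  apply: (@le_trans _ _ (s * a + s * b)); last by rewrite lerDl ltW.
  by apply: lerD; rewrite ler_norml; apply/andP; split; lra.
have -> : 4 * (e / (4 * ((a + b) ^+ 2 + 1))) * (s * (a + b)) ^+ 2 =
  e * s ^+ 2 * ((a + b) ^+ 2 / ((a + b) ^+ 2 + 1)).
  by field; rewrite gt_eqF// ltr_wpDl// sqr_ge0.
apply: ler_piMr; first by rewrite mulr_ge0 ?sqr_ge0// ltW.
by rewrite ler_pdivrMr ?mul1r ?lerDl// ltr_wpDl// sqr_ge0.
Qed.

End Goursat.

(** * Means over circles *)

Section CircleMean.
Variable R : realType.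
Implicit Types (H F f : R[i]^o -> R[i]) (r : R).

Definition cmean r H : R[i] := cint 0 1 (fun t => H (circ r t)).

Definition continuous_on_circle r H := forall t, 0 <= t <= 1 -> continuous_at H (circ r t).

Lemma continuous_on_itv_circ r H : continuous_on_circle r H ->
  continuous_on_itv 0 1 (fun t => H (circ r t)).
Proof.
move=> cH t t01; apply: continuous_at_comp; first exact: continuous_circ.
exact: cH.
Qed.

Lemma cmean_cst r (k : R[i]) : cmean r (fun=> k) = k.
Proof. by rewrite /cmean cint_cst// subr0 mul1r. Qed.

Lemma normc_cmean_le r H (M : R) : continuous_on_circle r H ->
  (forall t, 0 <= t <= 1 -> normc (H (circ r t)) <= M) ->
  normc (cmean r H) <= 2 * M.
Proof.
move=> cH HM; have := normc_cint_le ler01 (continuous_on_itv_circ cH) HM.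
by rewrite subr0 mulr1.
Qed.

Lemma eq_cmean r F H : (forall t, F (circ r t) = H (circ r t)) ->
  cmean r F = cmean r H.
Proof. by move=> e; apply: eq_cint. Qed.

Lemma cmeanB r F H : continuous_on_circle r F -> continuous_on_circle r H ->
  cmean r (fun w => F w - H w) = cmean r F - cmean r H.
Proof. by move=> cF cH; apply: cintB; exact: continuous_on_itv_circ. Qed.

Lemma cmeanZ r (k : R[i]) H : continuous_on_circle r H ->
  cmean r (fun w => k * H w) = k * cmean r H.
Proof. by move=> cH; apply: cintZ; exact: continuous_on_itv_circ. Qed.

Lemma normc_cmeanB_le r s F H (M : R) :
  continuous_on_circle r F -> continuous_on_circle s H ->
  (forall t, 0 <= t <= 1 -> normc (F (circ r t) - H (circ s t)) <= M) ->
  normc (cmean r F - cmean s H) <= 2 * M.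
Proof.
move=> /continuous_on_itv_circ cF /continuous_on_itv_circ cH FH.
rewrite /cmean -cintB//.
have := normc_cint_le ler01 (continuous_on_itvB cF cH) FH.
by rewrite subr0 mulr1.
Qed.

Lemma circle_bounded r H : continuous_on_circle r H ->
  exists2 B, 0 <= B & forall t, 0 <= t <= 1 -> normc (H (circ r t)) <= B.
Proof.
move=> cH.
have [|c _ cP] := @EVT_max R (fun t => normc (H (circ r t))) 0 1 ler01.
  apply: continuous_in_subspaceT => t; rewrite inE/= in_itv/= => t01.
  exact: continuous_at_normc (continuous_on_itv_circ cH t01).
exists (normc (H (circ r c))); first exact: normc_ge0.
by move=> t t01; apply: cP; rewrite in_itv.
Qed.

(** Cauchy's theorem for an annulus: in the logarithmic coordinate it becomes a
  rectangle whose horizontal sides cancel by periodicity. *)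
Lemma cauchy_annulus H (r1 r2 : R) : 0 < r1 -> r1 <= r2 ->
  (forall p, r1 <= normc p <= r2 -> exists l, cderiv H p l) ->
  cmean r1 H = cmean r2 H.
Proof.
move=> r10 r12 dH.
have r20 : 0 < r2 := lt_le_trans r10 r12.
have pi20 : 0 < 2 * pi :> R by rewrite mulr_gt0// pi_gt0.
pose x r := ln r / (2 * pi) : R.
have xK r : 0 < r -> expR (2 * pi * x r) = r.
  by move=> r0; rewrite mulrC divfK ?gt_eqF// lnK.
have x12 : x r1 <= x r2 by rewrite ler_pM2r ?invr_gt0// ler_ln.
pose g (s : R[i]^o) : R[i] := H (expC ((2 * pi)%:C * s)).
have g0 : rect_int g (x r1) (x r2) 0 1 = 0.
  apply: goursat_rectangle => // u v /andP[u1 u2] _.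
  have dm : cderiv (fun s : R[i]^o => (2 * pi)%:C * s) (u +i* v)
      (0 * (u +i* v) + (2 * pi)%:C * 1).
    by apply: cderivM; [exact: cderiv_cst|exact: cderiv_id].
  have [l dl] : exists l, cderiv H (expC ((2 * pi)%:C * (u +i* v))) l.
    apply: dH; rewrite expC_circ normc_circ ?expR_ge0//.
    by rewrite -[X in X <= _ <= _]xK// -[X in _ <= _ <= X]xK// !ler_expR !ler_pM2l// u1.
  have := cderiv_comp (cderiv_comp dm (cderiv_expC _)) dl.
  by move=> ?; eexists; eassumption.
have cH r : r1 <= r <= r2 -> continuous_on_circle r H.
  move=> rr t t01; have [|l /cderiv_continuous//] := dH (circ r t).
  by rewrite normc_circ//; case/andP: rr => h _; rewrite (le_trans _ h)// ltW.
move: g0; rewrite /rect_int.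
have gE r t : 0 < r -> g (x r +i* t) = H (circ r t).
  by move=> r0; rewrite /g expC_circ xK.
rewrite (@eq_cint _ (x r1) (x r2) _ (fun=> 0)); last first.
  by move=> t _; rewrite /g !expC_circ circ_periodic subrr.
rewrite cint_cst// mulr0 add0r.
rewrite (@eq_cint _ 0 1 _ (fun t => H (circ r2 t) - H (circ r1 t))); last first.
  by move=> t _; rewrite !gE.
rewrite cintB; last 2 first.
- by apply: continuous_on_itv_circ; apply: cH; rewrite r12 lexx.
- by apply: continuous_on_itv_circ; apply: cH; rewrite r12 lexx.
by move=> /eqP; rewrite mulf_eq0 -normc_eq0 normc_i oner_eq0/= subr_eq0 => /eqP.
Qed.

(** Shrinking the circle does not change the mean, and the means over small
  circles tend to the value at the centre. *)
Lemma cmean_center H r : 0 < r -> continuous_at H 0 ->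
  (forall p, 0 < normc p <= r -> exists l, cderiv H p l) ->
  cmean r H = H 0.
Proof.
move=> r0 cH dH; apply/eqP; rewrite -subr_eq0; apply/eqP; apply: normc_small_eq0 => e e0.
have e20 : 0 < e / 2 by rewrite divr_gt0.
have /nearC[d d0 Hd] := cH _ e20.
pose s := Num.min r (d / 2).
have s0 : 0 < s by rewrite lt_min r0 divr_gt0.
have sr : s <= r by rewrite ge_min lexx.
have sd : s < d by rewrite gt_min (_ : d / 2 < d) ?orbT// ltr_pdivrMr// ltr_pMr// ltr1n.
rewrite -(cauchy_annulus s0 sr); last first.
  by move=> p /andP[sp pr]; apply: dH; rewrite pr (lt_le_trans s0 sp).
rewrite -(cmean_cst s (H 0)) -[leRHS](divfK (_ : 2 != 0)) ?pnatr_eq0// mulrC.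
apply: normc_cmeanB_le.
- move=> t _; have [|l /cderiv_continuous//] := dH (circ s t).
  by rewrite normc_circ ?s0 ?sr// ltW.
- by move=> t _; exact: continuous_at_cst.
by move=> t _; apply/ltW/Hd; rewrite subr0 normc_circ// ltW.
Qed.

(** The circle being compact, joint continuity makes the integrand converge
  uniformly in the angle. *)
Lemma cmean_continuous H r0 : (forall p, continuous_at H p) ->
  forall e, 0 < e -> \forall r \near r0, normc (cmean r H - cmean r0 H) <= e.
Proof.
move=> cH e e0.
have ccirc (u : R * R) : continuous_at (fun u : R * R => circ u.2 u.1) u.
  have cs : {for u, continuous (fun u : R * R => u.2)} by exact: cvg_snd.
  have ct : {for u, continuous (fun u : R * R => 2 * pi * u.1)}.
    by apply: (@continuousM R); [exact: cst_continuous|exact: cvg_fst].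
  apply: continuous_at_ReIm.
  - apply: (@continuousM R) => //.
    by apply: (@continuous_comp _ _ _ (fun u : R * R => 2 * pi * u.1) cos) => //; exact: continuous_cos.
  - apply: (@continuousM R) => //.
    by apply: (@continuous_comp _ _ _ (fun u : R * R => 2 * pi * u.1) sin) => //; exact: continuous_sin.
have e40 : 0 < e / 4 by rewrite divr_gt0.
have cmp : near_covering (`[0, 1]%classic : set R).
  by apply/compact_near_coveringP; exact: segment_compact.
have := cmp R (nbhs r0) (fun r t => normc (H (circ r t) - H (circ r0 t)) < e / 2) _.
have e2 : e / 2 = e / 4 + e / 4 by field.
move=> H1; near=> r.
rewrite -[leRHS](divfK (_ : 2 != 0)) ?pnatr_eq0// mulrC.
have cHc s : continuous_on_circle s H by move=> t _; exact: cH.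
apply: normc_cmeanB_le => // t t01; apply: ltW.
suff : (`[0, 1]%classic : set R) `<=` (fun t => normc (H (circ r t) - H (circ r0 t)) < e / 2).
  by apply; rewrite /= in_itv.
near: r; apply: H1 => t _.
have h1 : \forall t' \near t & r \near r0, normc (H (circ r t') - H (circ r0 t)) < e / 4.
  exact: (continuous_at_comp (ccirc (t, r0)) (cH _)).
have h2 : \forall t' \near t & r \near r0, normc (H (circ r0 t') - H (circ r0 t)) < e / 4.
  have : \forall t' \near t, normc (H (circ r0 t') - H (circ r0 t)) < e / 4.
    exact: (continuous_at_comp (continuous_circ r0 t) (cH _)).
  move=> h; exists ([set t' | normc (H (circ r0 t') - H (circ r0 t)) < e / 4], setT).
    by split => //; exact: filterT.
  by move=> [t' r] [].
apply: filterS2 h1 h2 => -[t' r] /= h1 h2.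
rewrite -(subrKA (H (circ r0 t))) e2 (le_lt_trans (le_normcD _ _))//.
by rewrite ltrD// normcB.
Unshelve. all: end_near. Qed.

End CircleMean.

(** * Cauchy's formula and iterated derivatives *)

Section CauchyFormula.
Variable R : realType.
Implicit Types (F f : R[i]^o -> R[i]) (a : R[i]) (r : R).

Definition holomorphic f := forall p, exists l, cderiv f p l.

(** The value [l] at [a] is meant to be the derivative, which removes the
  singularity of the difference quotient. *)
Definition slope f a l : R[i]^o -> R[i] :=
  fun z => if z == a then l else (f z - f a) / (z - a).

Lemma slope_continuous f a l : cderiv f a l -> continuous_at (slope f a l) (a : R[i]^o).
Proof.
move=> [q [cq ql fq]]; apply: (continuous_at_near _ _ cq).
  by rewrite /slope eqxx.
near=> w; rewrite /slope; case: eqP => [->//|/eqP wa].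
have -> : f w - f a = q w * (w - a) by near: w.
by rewrite mulfK// subr_eq0.
Unshelve. all: end_near. Qed.

Lemma cderiv_subc (a p : R[i]^o) : cderiv (fun w => w - a) p 1.
Proof.
by rewrite -[X in cderiv _ _ X]addr0; apply: cderivD; [exact: cderiv_id|exact: cderiv_cst].
Qed.

Lemma cderiv_slope f a l (p : R[i]^o) : p != a -> (exists k, cderiv f p k) ->
  exists k, cderiv (slope f a l) p k.
Proof.
move=> pa [k df].
have pa0 : p - a != 0 by rewrite subr_eq0.
have d1 := cderivD df (cderiv_cst (- f a) p).
have d2 := @cderivV _ (fun w => w - a) p 1 pa0 (cderiv_subc a p).
eexists; apply: cderiv_near (cderivM d1 d2).
  by rewrite /slope (negbTE pa).
apply/nearC; exists (normc (p - a)); first by rewrite normc_gt0.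
move=> w wpa; rewrite /slope; case: eqP => // wa.
by move: wpa; rewrite wa normcB ltxx.
Qed.

Lemma continuous_on_circleM r F f : continuous_on_circle r F ->
  continuous_on_circle r f -> continuous_on_circle r (fun w => F w * f w).
Proof.
by move=> cF cf t t01; apply: continuous_atM; [exact: cF|exact: cf].
Qed.

Lemma continuous_on_circle_holo r f : holomorphic f -> continuous_on_circle r f.
Proof. by move=> hf t _; have [l /cderiv_continuous] := hf (circ r t). Qed.

Lemma continuous_on_circle_id r : continuous_on_circle r (fun w => w).
Proof. by move=> t _; exact: continuous_at_id. Qed.

Lemma circ_neq a r t : normc a < r -> circ r t != a.
Proof.
move=> ar; apply: contraTneq ar => <-.
have [r0|r0] := leP 0 r; first by rewrite normc_circ// ltxx.
by rewrite -leNgt (le_trans (ltW r0))// normc_ge0.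
Qed.

Lemma continuous_on_circle_inv r a : normc a < r ->
  continuous_on_circle r (fun w => (w - a)^-1).
Proof.
move=> ar t _; apply: continuous_atV; first by rewrite subr_eq0 circ_neq.
by have := cderiv_continuous (cderiv_subc a (circ r t)).
Qed.

Lemma continuous_on_circle_invX r a n : normc a < r ->
  continuous_on_circle r (fun w => (w - a)^-1 ^+ n).
Proof.
by move=> ar t t01; apply: continuous_atX; exact: continuous_on_circle_inv.
Qed.

(** The function vanishes at the centre and is holomorphic off [a], so its means are
  zero inside the circle through [a] and constant outside; being continuous in the
  radius, they cannot jump. *)
Lemma cmean_slope f a l r : holomorphic f -> cderiv f a l -> normc a < r ->
  cmean r (fun z => z * slope f a l z) = 0.
Proof.
move=> hf dfa ar; pose H (z : R[i]^o) := z * slope f a l z; rewrite -[LHS]/(cmean r H).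
have dH p : p != a -> exists k, cderiv H p k.
  move=> pa; have [k dk] := cderiv_slope l pa (hf p).
  by eexists; exact: cderivM (cderiv_id p) dk.
have cH p : continuous_at H p.
  have [->|/dH[k /cderiv_continuous//]] := eqVneq p a.
  by apply: continuous_atM; [exact: continuous_at_id|exact: slope_continuous].
have inside s : 0 < s -> a = 0 \/ s < normc a -> cmean s H = 0.
  move=> s0 sa; rewrite cmean_center// ?/H ?mul0r// => p /andP[p0 ps].
  apply: dH; apply: contraTneq ps => pa; case: sa => [a0|sa].
    by move: p0; rewrite pa a0 normc0 ltxx.
  by rewrite -ltNge pa.
have [a0|a0] := eqVneq a 0.
  by apply: inside; [rewrite (le_lt_trans _ ar)// normc_ge0|left].
have na0 : 0 < normc a by rewrite normc_gt0.
apply: normc_small_eq0 => e e0.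
have e20 : 0 < e / 2 by rewrite divr_gt0.
have /nbhs_normP[d d0' Hd] := cmean_continuous (normc a) cH e20.
have d0 : 0 < d := d0'.
(* a radius [s] inside and a radius [u] outside the circle through [a], both
   close enough for the continuity of the mean *)
pose s := normc a - Num.min (d / 2) (normc a / 2).
pose u := Num.min r (normc a + d / 2).
have d2 : d / 2 < d by rewrite ltr_pdivrMr// ltr_pMr// ltr1n.
have m0 : 0 < Num.min (d / 2) (normc a / 2) by rewrite lt_min !divr_gt0.
have m1 : Num.min (d / 2) (normc a / 2) <= d / 2 by rewrite ge_min lexx.
have m2 : Num.min (d / 2) (normc a / 2) <= normc a / 2 by rewrite ge_min lexx orbT.
have s0 : 0 < s by rewrite /s; lra.
have sa : s < normc a by rewrite /s; lra.
have ua : normc a < u by rewrite lt_min ar ltrDl divr_gt0.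
have ur : u <= r by rewrite ge_min lexx.
have ud : u <= normc a + d / 2 by rewrite ge_min lexx orbT.
have -> : cmean r H = cmean u H.
  apply/esym/cauchy_annulus => //; first exact: lt_trans ua.
  move=> p /andP[up _]; apply: dH; apply: contraTneq up => ->.
  by rewrite -ltNge.
have h1 : normc (cmean u H - cmean (normc a) H) <= e / 2.
  by apply: Hd; rewrite /= ltr_norml; apply/andP; split; lra.
have h2 : normc (cmean s H - cmean (normc a) H) <= e / 2.
  by apply: Hd; rewrite /= ltr_norml; apply/andP; split; rewrite /s; lra.
rewrite (inside s)// in h2; last by right.
rewrite sub0r normcN in h2.
rewrite -(subrK (cmean (normc a) H) (cmean u H)) (splitr e).
by rewrite (le_trans (le_normcD _ _))// lerD.
Qed.

(** The mean does not depend on the radius, and the integrand tends to 1 at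
  infinity. *)
Lemma cmean_kernel a r : normc a < r -> cmean r (fun w => w * (w - a)^-1) = 1.
Proof.
move=> ar; have r0 : 0 < r by rewrite (le_lt_trans _ ar)// normc_ge0.
apply/eqP; rewrite -subr_eq0; apply/eqP; apply: normc_small_eq0 => e e0.
have na := normc_ge0 a.
(* on this circle the integrand is within [e / 2] of 1 *)
pose s := r + normc a + 2 * normc a / e.
have as0 : 0 <= 2 * normc a / e by rewrite divr_ge0 ?mulr_ge0// ltW.
have rs : r <= s by rewrite /s; lra.
have as1 : normc a < s by exact: lt_le_trans rs.
rewrite (cauchy_annulus r0 rs); last first.
  move=> p /andP[rp _]; have pa : p - a != 0.
    rewrite subr_eq0; apply: contraTneq rp => ->; by rewrite -ltNge.
  by eexists; exact: cderivM (cderiv_id p) (@cderivV _ (fun w => w - a) p 1 pa (cderiv_subc a p)).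
rewrite -(cmean_cst s 1) -[leRHS](divfK (_ : 2 != 0)) ?pnatr_eq0// mulrC.
apply: normc_cmeanB_le.
- apply: continuous_on_circleM; first exact: continuous_on_circle_id.
  exact: continuous_on_circle_inv.
- by move=> t _; exact: continuous_at_cst.
move=> t _; set w := circ s t.
have wa : w - a != 0 by rewrite subr_eq0 circ_neq.
have -> : w * (w - a)^-1 - 1 = a * (w - a)^-1 by field.
rewrite normcM normcV ler_pdivrMr ?normc_gt0//.
have : s - normc a <= normc (w - a).
  by have := ler_normcB w a; rewrite normc_circ// ltW// (lt_le_trans r0).
have : normc a <= e / 2 * (s - normc a).
  have -> : e / 2 * (s - normc a) = e / 2 * r + normc a.
    by rewrite /s; field; rewrite gt_eqF.
  by rewrite lerDr mulr_ge0 ?divr_ge0// ltW.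
move=> h1 h2; apply: (le_trans h1); apply: ler_wpM2l => //.
by rewrite divr_ge0// ltW.
Qed.

(** The mean computed in [cmean_slope] splits into the two sides, because the
  kernel has mean 1. *)
Theorem cauchy_formula f a r : holomorphic f -> normc a < r ->
  cmean r (fun w => f w * w * (w - a)^-1) = f a.
Proof.
move=> hf ar; have [l dl] := hf a.
have ck : continuous_on_circle r (fun w => w * (w - a)^-1).
  apply: continuous_on_circleM; first exact: continuous_on_circle_id.
  exact: continuous_on_circle_inv.
have cfk : continuous_on_circle r (fun w => f w * w * (w - a)^-1).
  apply: continuous_on_circleM; last exact: continuous_on_circle_inv.
  apply: continuous_on_circleM; last exact: continuous_on_circle_id.
  exact: continuous_on_circle_holo.
have := cmean_slope hf dl ar.
rewrite (@eq_cmean _ r _ (fun w => f w * w * (w - a)^-1 - f a * (w * (w - a)^-1))).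
  rewrite cmeanB//; last first.
    by move=> t t01; apply: continuous_atZ; exact: ck.
  by rewrite cmeanZ// cmean_kernel// mulr1 => /eqP; rewrite subr_eq0 => /eqP.
by move=> t; rewrite /slope (negbTE (circ_neq t ar)); ring.
Qed.

(** With u = 1/(w - a), v = 1/(w - b) and h = b - a one has v - u = h u v, and
  the claim is that b |-> 1/(w - b)^n has derivative n/(w - a)^(n+1) at a, with a quadratic
  error that is uniform as long as w stays away from a and b. *)
Lemma power_increment_bound n (M : R) : 0 <= M -> exists2 C, 0 <= C &
  forall u v h : R[i], normc u <= M -> normc v <= M -> v - u = h * u * v ->
    normc (v ^+ n - u ^+ n - n%:R * h * u ^+ n.+1) <= C * normc h ^+ 2.
Proof.
move=> M0; elim: n => [|n [C C0 IH]].
  exists 0 => // u v h _ _ _.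
  by rewrite !expr0 subrr mulr0n !mul0r subrr normc0.
exists (M * C + M ^+ n.+3 + n%:R * M ^+ n.+3).
  have Mn : 0 <= M ^+ n.+3 by exact: exprn_ge0.
  apply: addr_ge0; last exact: mulr_ge0 (ler0n _ _) Mn.
  by apply: addr_ge0 => //; exact: mulr_ge0.
move=> u v h uM vM vu.
have -> : v ^+ n.+1 - u ^+ n.+1 - n.+1%:R * h * u ^+ n.+2 =
  v * (v ^+ n - u ^+ n - n%:R * h * u ^+ n.+1) +
  h ^+ 2 * (u ^+ n.+2 * v) + n%:R * (h ^+ 2 * (u ^+ n.+2 * v)).
  have vE : v = u + h * u * v by rewrite -vu addrC subrK.
  have k1 : u ^+ n * (v - u - h * u ^+ 2) = h ^+ 2 * (u ^+ n.+2 * v).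
    rewrite vu !exprS; have -> : h * u * v - h * (u * (u * u ^+ 0)) = h * u * (v - u).
      by rewrite expr0; ring.
    by rewrite vu expr0; ring.
  have k2 : n%:R * h * u ^+ n.+1 * (v - u) = n%:R * (h ^+ 2 * (u ^+ n.+2 * v)).
    by rewrite vu !exprS expr0; ring.
  by rewrite -k2 -[h ^+ 2 * _ in RHS]k1 !exprS expr0 -natr1; ring.
have hh : normc (h ^+ 2 * (u ^+ n.+2 * v)) <= M ^+ n.+3 * normc h ^+ 2.
  rewrite normcM normcX mulrC ler_wpM2r ?sqr_ge0// normcM normcX [leRHS]exprSr.
  by rewrite ler_pM ?exprn_ge0 ?normc_ge0// lerXn2r ?nnegrE ?normc_ge0.
rewrite !mulrDl (le_trans (le_normcD _ _))// lerD//.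
  rewrite (le_trans (le_normcD _ _))// lerD//.
  by rewrite normcM -[leRHS]mulrA ler_pM ?normc_ge0// IH.
rewrite normcM -[leRHS]mulrA ler_pM ?normc_ge0//.
by rewrite -(rmorph_nat (real_complex R)) normc_real ger0_norm.
Qed.

(** The quadratic error of [power_increment_bound] is uniform over the circle, so
  it survives taking the mean. *)
Lemma cderiv_cauchy_kernel F r n a : continuous_on_circle r F -> normc a < r ->
  cderiv (fun b => cmean r (fun w => F w * (w - b)^-1 ^+ n)) a
    (n%:R * cmean r (fun w => F w * (w - a)^-1 ^+ n.+1)).
Proof.
move=> cF ar; apply/cderivP => e e0.
have r0 : 0 <= r by rewrite ltW// (le_lt_trans _ ar)// normc_ge0.
have [B B0 FB] := circle_bounded cF.
pose rho := (r - normc a) / 2.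
have rho0 : 0 < rho by rewrite divr_gt0// subr_gt0.
have rhoV0 : 0 <= rho^-1 by rewrite invr_ge0 ltW.
have [C C0 HC] := power_increment_bound n rhoV0.
have K0 : 0 < 2 * (B * C) + 1.
  by have := mulr_ge0 B0 C0; lra.
apply/nearC; exists (Num.min rho (e / (2 * (B * C) + 1))).
  by rewrite lt_min rho0 divr_gt0.
move=> b; rewrite lt_min => /andP[b1 b2].
have br : normc b < r.
  have := le_normcD a (b - a); rewrite addrC subrK; rewrite /rho in b1; lra.
have cK c m : normc c < r -> continuous_on_circle r (fun w => F w * (w - c)^-1 ^+ m).
  move=> cr; apply: continuous_on_circleM => //; exact: continuous_on_circle_invX.
have cZ (k : R[i]) G : continuous_on_circle r G -> continuous_on_circle r (fun w => k * G w).
  by move=> cG t t01; apply: continuous_atZ; exact: cG.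
have cB G G' : continuous_on_circle r G -> continuous_on_circle r G' ->
    continuous_on_circle r (fun w => G w - G' w).
  by move=> cG cG' t t01; apply: continuous_atB; [exact: cG|exact: cG'].
set h := b - a in b1 b2 *.
have -> : n%:R * cmean r (fun w => F w * (w - a)^-1 ^+ n.+1) * h =
  cmean r (fun w => n%:R * h * (F w * (w - a)^-1 ^+ n.+1)).
  by rewrite cmeanZ; [ring|exact: cK].
rewrite -cmeanB; [|exact: cK..].
rewrite -cmeanB; [|by apply: (cB); exact: cK|by apply: (cZ); exact: cK].
apply: (@le_trans _ _ (2 * (B * (C * normc h ^+ 2)))).
  apply: normc_cmean_le.
    by apply: (cB); [apply: (cB); exact: cK|apply: (cZ); exact: cK].
  move=> t t01; set w := circ r t.
  have wa : w - a != 0 by rewrite subr_eq0 circ_neq.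
  have wb : w - b != 0 by rewrite subr_eq0 circ_neq.
  have nw : normc w = r by rewrite normc_circ.
  have ua : normc (w - a)^-1 <= rho^-1.
    rewrite normcV lef_pV2 ?posrE ?normc_gt0//.
    have := ler_normcB w a; rewrite /rho in rho0 *; lra.
  have ub : normc (w - b)^-1 <= rho^-1.
    rewrite normcV lef_pV2 ?posrE ?normc_gt0//.
    have := ler_normcB w b; have := le_normcD a h.
    by rewrite /h (addrC a) subrK -/h; rewrite /rho in b1 *; lra.
  have -> : F w * (w - b)^-1 ^+ n - F w * (w - a)^-1 ^+ n -
      n%:R * h * (F w * (w - a)^-1 ^+ n.+1) =
    F w * ((w - b)^-1 ^+ n - (w - a)^-1 ^+ n - n%:R * h * (w - a)^-1 ^+ n.+1).
    by ring.
  rewrite normcM ler_pM ?normc_ge0 ?FB// HC//.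
  by rewrite /h; field; rewrite wa wb.
have h0 := normc_ge0 h.
have -> : 2 * (B * (C * normc h ^+ 2)) = 2 * (B * C) * normc h * normc h by ring.
apply: ler_wpM2r => //.
move: b2; rewrite ltr_pdivlMr// => b2; lra.
Qed.

(** The formula is proved at all points of the disc at once, since each
  derivative is a limit over neighbouring points. In passing it shows that the
  iterated limits exist. *)
Theorem derive1n_cauchy f a r n : holomorphic f -> normc a < r ->
  derive1n n (f : R[i]^o -> R[i]^o) a =
    (n`!)%:R * cmean r (fun w => f w * w * (w - a)^-1 ^+ n.+1).
Proof.
move=> hf; have cF : continuous_on_circle r (fun w => f w * w).
  apply: continuous_on_circleM; last exact: continuous_on_circle_id.
  exact: continuous_on_circle_holo.
elim: n a => [|n IH] a ar.
  by rewrite /= fact0 mul1r -(cauchy_formula hf ar).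
rewrite /derive1n iterS; apply: cderiv_derive1.
have := cderivM (cderiv_cst (n`!)%:R a) (cderiv_cauchy_kernel n.+1 cF ar).
rewrite mul0r add0r mulrA -natrM mulnC -factS; apply: cderiv_near.
  by rewrite -IH.
apply/nearC; exists (r - normc a); first by rewrite subr_gt0.
move=> w wa; rewrite -IH//.
have := le_normcD a (w - a); rewrite addrC subrK; lra.
Qed.

End CauchyFormula.

(** * Taylor series and parity *)

Section Taylor.
Variable R : realType.
Implicit Types (f : R[i]^o -> R[i]) (a : R[i]) (r : R).

(** Under the integral sign of Cauchy's formula, x^N/(1 - x) equals
  x^N + x^(N+1)/(1 - x) for x = a/w; each step splits off one Taylor term. *)
Lemma taylor_remainder f a r N : holomorphic f -> normc a < r ->
  f a - \sum_(n < N) a ^+ n * (derive1n n (f : R[i]^o -> R[i]^o) 0 / (n`!)%:R) =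
  cmean r (fun w => f w * w * (w - a)^-1 * (a * w^-1) ^+ N).
Proof.
move=> hf ar; have r0 : 0 < r by rewrite (le_lt_trans _ ar)// normc_ge0.
have cV n : continuous_on_circle r (fun w => w^-1 ^+ n).
  move=> t _; apply: continuous_atX; apply: continuous_atV.
    exact: circ_neq0.
  exact: continuous_at_id.
have cf := @continuous_on_circle_holo _ r _ hf.
have cid := @continuous_on_circle_id R r.
elim: N => [|N IH].
  rewrite big_ord0 subr0 -(cauchy_formula hf ar).
  by apply: eq_cmean => t; rewrite expr0 mulr1.
have fact0' : (N`!)%:R != 0 :> R[i] by rewrite pnatr_eq0 -lt0n fact_gt0.
rewrite big_ord_recr/= opprD addrA IH (derive1n_cauchy N hf (_ : normc 0 < r)) ?normc0//.
rewrite [X in a ^+ N * X]mulrC mulKf// -cmeanZ; last first.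
  apply: continuous_on_circleM; first exact: continuous_on_circleM.
  by apply: continuous_on_circle_invX; rewrite normc0.
rewrite -cmeanB; last 2 first.
- apply: continuous_on_circleM.
    apply: continuous_on_circleM; first exact: continuous_on_circleM.
    exact: continuous_on_circle_inv.
  move=> t t01; apply: continuous_atX; apply: continuous_atZ.
  by have := cV 1%N t t01; under [X in continuous_at X]eq_fun do rewrite expr1.
- move=> t t01; apply: continuous_atZ; apply: continuous_on_circleM t01.
    exact: continuous_on_circleM.
  by apply: continuous_on_circle_invX; rewrite normc0.
apply: eq_cmean => t; set w := circ r t.
have w0 : w != 0 by exact: circ_neq0.
have wa : w - a != 0 by rewrite subr_eq0 circ_neq.
rewrite subr0 !exprMn !exprS; field.
by rewrite wa w0.
Qed.

(** On a circle of radius larger than the modulus of [a] the remainder decays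
  geometrically. *)
Lemma taylor_cvg f a : holomorphic f -> forall e, 0 < e ->
  \forall N \near \oo, normc (f a -
    \sum_(n < N) a ^+ n * (derive1n n (f : R[i]^o -> R[i]^o) 0 / (n`!)%:R)) < e.
Proof.
move=> hf e e0; pose r := normc a + 1.
have ar : normc a < r by rewrite ltrDl.
have r0 : 0 < r by rewrite (le_lt_trans _ ar)// normc_ge0.
have cfk : continuous_on_circle r (fun w => f w * w * (w - a)^-1).
  apply: continuous_on_circleM; last exact: continuous_on_circle_inv.
  apply: continuous_on_circleM; last exact: continuous_on_circle_id.
  exact: continuous_on_circle_holo.
have [B B0 HB] := circle_bounded cfk.
pose q := normc a / r.
have q0 : 0 <= q by rewrite divr_ge0 ?normc_ge0// ltW.
have q1 : `|q| < 1 by rewrite ger0_norm// ltr_pdivrMr// mul1r.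
have B20 : 0 < 2 * B + 1 by rewrite ltr_wpDl// mulr_ge0.
have eB : 0 < e / (2 * B + 1) by rewrite divr_gt0.
have /cvgrPdist_lt/(_ _ eB) := cvg_expr q1.
apply: filterS => N; rewrite sub0r normrN ger0_norm ?exprn_ge0// => qN.
rewrite (taylor_remainder N hf ar).
rewrite (@le_lt_trans _ _ (2 * (B * q ^+ N)))//.
  apply: normc_cmean_le.
    apply: continuous_on_circleM => // t t01.
    apply: continuous_atX; apply: continuous_atZ; apply: continuous_atV.
      exact: circ_neq0.
    exact: continuous_at_id.
  move=> t t01; rewrite normcM ler_pM ?normc_ge0// ?HB//.
  by rewrite normcX normcM normcV normc_circ// ltW.
move: qN; rewrite ltr_pdivlMr//; have := mulr_ge0 B0 (exprn_ge0 N q0).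
have := exprn_ge0 N q0; move: (q ^+ N) => x; nra.
Qed.

(** If all Taylor coefficients of one parity vanish, the Taylor series shows
  that the function has the opposite parity. *)
Lemma holomorphic_parity f (b : bool) : holomorphic f ->
  (forall n, odd n = b -> derive1n n (f : R[i]^o -> R[i]^o) 0 = 0) ->
  forall z, f (- z) = (-1) ^+ (~~ b) * f z.
Proof.
move=> hf f0 z; apply/eqP; rewrite -subr_eq0; apply/eqP.
apply: normc_small_eq0 => e e0.
have e20 : 0 < e / 2 by rewrite divr_gt0.
have [N _ /(_ N (leqnn N)) [/ltW h1 /ltW h2]] := filterI (taylor_cvg z hf e20) (taylor_cvg (- z) hf e20).
set S := \sum_(n < N) _ in h1; set S' := \sum_(n < N) _ in h2.
have S'E : S' = (-1) ^+ (~~ b) * S.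
  rewrite /S /S' mulr_sumr; apply: eq_bigr => n _.
  have [nb|nb] := eqVneq (odd n) b; first by rewrite f0// !(mul0r, mulr0).
  rewrite (exprNn z) -(signr_odd _ n).
  have -> : odd n = ~~ b by case: (odd n) (b) nb => [] [].
  by rewrite !mulrA.
have -> : f (- z) - (-1) ^+ (~~ b) * f z =
  (f (- z) - S') + (- (-1) ^+ (~~ b)) * (f z - S) by rewrite S'E; ring.
rewrite (le_trans (le_normcD _ _))// (splitr e) lerD//.
by rewrite normcM normcN normcX normcN normc1 expr1n mul1r.
Qed.

End Taylor.

(** * Periodic functions with finite integral *)

Section PeriodicIntegrable.
Variable R : realType.
Local Notation mu := (@lebesgue_measure R).

(** Every simple function below [c] times the indicator of [U] is below [F], so
  the suprema that define the two integrals compare. *)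
Lemma ge0_integral_ge_cst d (T : measurableType d) (nu : {measure set T -> \bar R})
    (F : T -> R) (U : set T) (c : R) :
  measurable U -> 0 <= c -> (forall x, 0 <= F x) -> (forall x, U x -> c <= F x) ->
  (c%:E * nu U <= \int[nu]_x (F x)%:E)%E.
Proof.
move=> mU c0 F0 cF; rewrite -integral_cst// integral_mkcond.
rewrite !ge0_integralTE//; last first.
  by move=> x; rewrite /patch; case: ifP; rewrite ?lee_fin.
apply: le_ereal_sup => _ [h /= hc <-]; exists h => //= x.
apply: (le_trans (hc x)); rewrite /patch; case: ifPn; rewrite lee_fin// inE.
exact: cF.
Qed.

(** If [F] is positive at a point, it exceeds a positive constant on a small
  square around it and, by periodicity, on all translates of this square by
  multiples of the period. Squares that are small against the period have
  disjoint translates, so the integral would exceed every bound. *)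
Lemma periodic_integrable_eq0 (F : R * R -> R) (v1 v2 : R) :
  (v1, v2) != (0, 0) -> continuous F -> (forall p, 0 <= F p) ->
  (forall x y, F (x + v1, y + v2) = F (x, y)) ->
  (\int[mu \x mu]_p (F p)%:E < +oo)%E -> forall p, F p = 0.
Proof.
move=> v0 cF F0 Fv Ifin [x y]; apply/eqP; rewrite eq_le F0 andbT leNgt.
apply/negP => Fp.
have Fvk k u w : F (u + k%:R * v1, w + k%:R * v2) = F (u, w).
  elim: k => [|k IH]; first by rewrite !mul0r !addr0.
  by rewrite -natr1 !mulrDl !mul1r !addrA Fv.
set c := F (x, y) / 2; have c0 : 0 < c by rewrite divr_gt0.
have [d d0 Fd] : exists2 d, 0 < d & forall u w,
    `|u - x| <= d -> `|w - y| <= d -> c <= F (u, w).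
  have cl : c < F (x, y) by rewrite ltr_pdivrMr// ltr_pMr// ltr1n.
  have [[A B] [/= /nbhs_normP[/= d1 d10 dA] /nbhs_normP[/= d2 d20 dB]] AB] :
    \forall q \near (x, y), c < F q by exact: (cvgr_gt _ (cF (x, y)) _ cl).
  exists (Num.min (d1 / 2) (d2 / 2)); first by rewrite lt_min !divr_gt0.
  move=> u w; rewrite !le_min => /andP[u1 _] /andP[_ w2].
  have h1 : d1 / 2 < d1 by rewrite ltr_pdivrMr// ltr_pMr// ltr1n.
  have h2 : d2 / 2 < d2 by rewrite ltr_pdivrMr// ltr_pMr// ltr1n.
  apply/ltW/AB; split => /=.
    by apply: dA; rewrite /= distrC (le_lt_trans u1).
  by apply: dB; rewrite /= distrC (le_lt_trans w2).
pose m := Num.max `|v1| `|v2|.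
have m0 : 0 < m.
  rewrite lt_max !normr_gt0; move: v0; apply: contraNT.
  by rewrite negb_or !negbK => /andP[/eqP-> /eqP->].
(* translates of a square of side [2 * e] that meet are less than one period
   apart, since [2 * e < m] *)
pose e := Num.min d (m / 3).
have e0 : 0 < e by rewrite lt_min d0 divr_gt0.
have ed : e <= d by rewrite ge_min lexx.
have em : e <= m / 3 by rewrite ge_min lexx orbT.
pose I (z : R) : set (measurableTypeR R) := `[z - e, z + e]%classic.
pose Q (k : nat) : set (measurableTypeR R * measurableTypeR R) :=
  I (x + k%:R * v1) `*` I (y + k%:R * v2).
have inI z u : I z u -> `|u - z| <= e.
  by rewrite /I /= in_itv/= => /andP[? ?]; rewrite ler_norml; apply/andP; split; lra.
have mI z : measurable (I z) by rewrite /I.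
have mQ k : measurable (Q k) by apply: measurableX.
have muI z : mu (I z) = (e + e)%:E.
  rewrite /I lebesgue_measure_itv/= lte_fin.
  have -> : z - e < z + e by lra.
  by rewrite -EFinB; congr (_%:E); ring.
have muQ k : (mu \x mu)%E (Q k) = ((e + e) * (e + e))%:E.
  by rewrite /Q product_measure1E// EFinM; congr (_ * _)%E; exact: muI.
have tQ : trivIset setT Q.
  apply/trivIsetP => j k _ _ jk; apply/seteqP; split=> // -[u w] [[/= ju jw] [/= ku kw]].
  have {ju jw ku kw} [h1 h2] : `|(j%:R - k%:R) * v1| <= 2 * e /\ `|(j%:R - k%:R) * v2| <= 2 * e.
    move: (inI _ _ ju) (inI _ _ jw) (inI _ _ ku) (inI _ _ kw).
    rewrite !ler_norml => /andP[? ?] /andP[? ?] /andP[? ?] /andP[? ?].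
    by split; apply/andP; split; lra.
  have h3 : `|j%:R - k%:R| * m <= 2 * e.
    by rewrite /m; case: (leP `|v1| `|v2|) => _; rewrite -normrM.
  have h4 : 1 <= `|j%:R - k%:R : R|.
    wlog kj : j k {jk h1 h2 h3} jk / (k < j)%N.
      move=> H; case: (ltngtP j k) jk => // [jk|kj] _; last by apply: H => //; rewrite gtn_eqF.
      by rewrite distrC; apply: H => //; rewrite gtn_eqF.
    by rewrite -natrB 1?ltnW// ger0_norm// ler1n subn_gt0.
  have : 1 * m <= `|j%:R - k%:R| * m by rewrite ler_wpM2r// ltW.
  by lra.
have Fc k q : Q k q -> c <= F q.
  case: q => u w [/= /inI ku /inI kw].
  rewrite -(subrK (k%:R * v1) u) -(subrK (k%:R * v2) w) Fvk.
  by apply: Fd; rewrite -addrA -opprD [_ * _ + _]addrC (le_trans _ ed).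
have bound (n : nat) : (c%:E * (n%:R * ((e + e) * (e + e)))%:E <=
    \int[mu \x mu]_p (F p)%:E)%E.
  have mU : measurable (\big[setU/set0]_(i < n) Q i).
    by apply: bigsetU_measurable => i _.
  apply: le_trans (@ge0_integral_ge_cst _ _ (mu \x mu)%E F _ c mU (ltW c0) F0 _).
    rewrite lee_pmul2l ?lte_fin// measure_bigsetU//.
    rewrite (eq_bigr (fun=> ((e + e) * (e + e))%:E)) => [|i _]; last exact: muQ.
    by rewrite sumEFin lee_fin sumr_const card_ord mulr_natl.
  by move=> q; rewrite -bigcup_mkord => -[k _]; exact: Fc.
have ge0I : (0 <= \int[mu \x mu]_p (F p)%:E)%E by apply: integral_ge0 => p _; rewrite lee_fin.
move: Ifin ge0I bound; case: (integral _ _ _) => // r _.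
rewrite lee_fin => r0 bound.
have k0 : 0 < c * ((e + e) * (e + e)) by rewrite !mulr_gt0// addr_gt0.
have := bound (Num.bound (r / (c * ((e + e) * (e + e))))).
rewrite -EFinM lee_fin leNgt mulrCA -ltr_pdivrMr//.
by rewrite archi_boundP// divr_ge0// ltW.
Qed.

End PeriodicIntegrable.

(** * Functions in Fock space *)

Section FockSpace.
Variable R : realType.
Implicit Types (f : R[i]^o -> R[i]^o) (beta z : R[i]).

Lemma entire_holomorphic f : entire f -> holomorphic f.
Proof. by move=> ef p; exact: derivable_cderiv. Qed.

Lemma fock_translate_holomorphic beta f :
  holomorphic f -> holomorphic (fock_translate beta f).
Proof.
move=> hf p; have [l dl] := hf (p - beta).
have d1 := cderiv_comp (cderiv_subc beta p) dl.
have d2 := cderivD (cderiv_cst (- (normc beta ^+ 2 / 2))%:C p)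
  (cderivM (cderiv_cst (conjc beta) p) (cderiv_id p)).
by eexists; exact: cderivM (cderiv_comp d2 (cderiv_expC _)) d1.
Qed.

Lemma fock_translate0 f z : fock_translate 0 f z = f z.
Proof.
rewrite /fock_translate subr0 -[RHS]mul1r -expC0; congr (expC _ * _).
rewrite normc0 expr0n mul0r oppr0 add0r; case: z => x y.
by apply/eqP; rewrite eq_complex /= oppr0 !mul0r subr0 addr0 !eqxx.
Qed.

(** Comparing the two parities at z + beta expresses f(z + 2 beta) through f(z),
  up to a unimodular factor, by the exponential of 2 conj(beta) (z + beta); the
  Gaussian weight changes by exactly the inverse square of its modulus. *)
Lemma fock_density_periodic beta f (s t : R[i]) : normc s = 1 -> normc t = 1 ->
  (forall z, f (- z) = s * f z) ->
  (forall z, fock_translate beta f (- z) = t * fock_translate beta f z) ->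
  forall z, normc (f (z + beta *+ 2)) ^+ 2 * expR (- normc (z + beta *+ 2) ^+ 2) =
    normc (f z) ^+ 2 * expR (- normc z ^+ 2).
Proof.
move=> s1 t1 fs ft z.
have tE w : normc (fock_translate beta f w) =
    expR (Re ((- (normc beta ^+ 2 / 2))%:C + conjc beta * w)) * normc (f (w - beta)).
  by rewrite /fock_translate normcM normc_expC.
have := congr1 (@normc R) (ft (z + beta)); rewrite (normcM t) t1 mul1r !tE.
rewrite addrK -opprD fs (normcM s) s1 mul1r -addrA -mulr2n.
set r := Re (conjc beta * (z + beta)).
have -> : Re ((- (normc beta ^+ 2 / 2))%:C + conjc beta * (z + beta)) =
  - (normc beta ^+ 2 / 2) + r by rewrite /r raddfD.
have -> : Re ((- (normc beta ^+ 2 / 2))%:C + conjc beta * - (z + beta)) =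
  - (normc beta ^+ 2 / 2) - r by rewrite /r mulrN raddfB.
move=> h.
have {h} h : normc (f (z + beta *+ 2)) = expR (r *+ 2) * normc (f z).
  apply: (mulfI (lt0r_neq0 (expR_gt0 (- (normc beta ^+ 2 / 2) - r)))).
  rewrite h mulrA -expRD; congr (expR _ * _).
  by rewrite mulr2n addrA subrK.
have -> : normc (z + beta *+ 2) ^+ 2 = normc z ^+ 2 + r *+ 4.
  rewrite /r !sqr_normc; case: (z) (beta) => [x y] [u v] /=.
  by ring.
rewrite h exprMn -expRM_natl opprD expRD.
have E : expR (2 * (r *+ 2)) * expR (- (r *+ 4)) = 1.
  have e0 : 2 * (r *+ 2) + - (r *+ 4) = 0 by rewrite -mulr_natr -[r *+ 4]mulr_natr; ring.
  by rewrite -expRD e0 expR0.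
transitivity (expR (2 * (r *+ 2)) * expR (- (r *+ 4)) *
  (normc (f z) ^+ 2 * expR (- normc z ^+ 2))); first by ring.
by rewrite E mul1r.
Qed.

Lemma continuous_fock_density f : holomorphic f ->
  continuous (fun p : R * R => normc (f (p.1 +i* p.2)) ^+ 2 *
    expR (- normc (p.1 +i* p.2) ^+ 2)).
Proof.
move=> hf p.
have cp : continuous_at (fun q : R * R => q.1 +i* q.2) p.
  by apply: continuous_at_ReIm; [exact: cvg_fst|exact: cvg_snd].
have cn : {for p, continuous (fun q : R * R => normc (q.1 +i* q.2))}.
  exact: continuous_at_normc.
have cf : {for p, continuous (fun q : R * R => normc (f (q.1 +i* q.2)))}.
  apply: continuous_at_normc; apply: continuous_at_comp cp _.
  by have [l /cderiv_continuous] := hf (p.1 +i* p.2).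
have csq (u : R * R -> R) : {for p, continuous u} -> {for p, continuous (fun q => u q ^+ 2)}.
  by move=> cu; exact: (@continuousM R _ u u p cu cu).
have cm : {for p, continuous (fun q : R * R => - normc (q.1 +i* q.2) ^+ 2)}.
  exact: (@continuousN R R _ _ p (csq _ cn)).
have cexp : {for p, continuous (fun q : R * R => expR (- normc (q.1 +i* q.2) ^+ 2))}.
  by apply: (@continuous_comp _ _ _ _ expR p cm); exact: continuous_expR.
exact: (@continuousM R _ _ _ p (csq _ cf) cexp).
Qed.

Lemma fock_sqnorm_lty f : (fock_sqnorm f < +oo)%E ->
  (\int[lebesgue_measure \x lebesgue_measure]_(p in [set: R * R])
     (normc (f (p.1 +i* p.2)) ^+ 2 * expR (- normc (p.1 +i* p.2) ^+ 2))%:E < +oo)%E.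
Proof.
rewrite /fock_sqnorm; set I := integral _ _ _ => fI.
rewrite ltey; apply: contraTneq fI => ->.
by rewrite gt0_muley ?lte_fin ?invr_gt0 ?pi_gt0.
Qed.

End FockSpace.

Theorem theorem1p4 (R : realType) (E : set nat)
    (hE : E = [set j | ~~ odd j] \/ E = [set j | odd j])
    (f : R[i]^o -> R[i]^o) (hf : fock_space f)
    (hf0 : forall j : nat, E j -> derive1n j f 0 = 0)
    (beta : R[i])
    (hUf0 : forall j : nat, (~` E) j ->
       derive1n j (fock_translate beta f) 0 = 0) :
  forall z : R[i], f z = 0.
Proof.
have [/entire_holomorphic holf fI] := hf.
have holU := fock_translate_holomorphic beta holf.
have [b [fb Ub]] : exists b, (forall n, odd n = b -> derive1n n f 0 = 0) /\
    (forall n, odd n = ~~ b -> derive1n n (fock_translate beta f) 0 = 0).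
  case: hE => EE; [exists false|exists true]; split => n nb.
  - by apply: hf0; rewrite EE /= nb.
  - by apply: hUf0; rewrite EE /= nb.
  - by apply: hf0; rewrite EE /= nb.
  - by apply: hUf0; rewrite EE /= nb.
have fpar := holomorphic_parity holf fb.
have Upar := holomorphic_parity holU Ub.
have n1 (c : bool) : normc ((-1) ^+ c : R[i]) = 1.
  by rewrite normcX normcN normc1 expr1n.
have [b0 z|b0] := eqVneq beta 0.
  have := Upar z; rewrite b0 !fock_translate0 fpar negbK.
  (* here the translate is [f] itself, which is therefore both even and odd *)
  have opp0 (w : R[i]) : w = - w -> w = 0.
    move=> wN; have : w *+ 2 == 0 by rewrite mulr2n {1}wN addNr.
    by rewrite mulrn_eq0 => /eqP.
  by case: (b) => /=; rewrite expr0 expr1 mul1r mulN1r => h; apply: opp0.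
have per := fock_density_periodic (n1 _) (n1 _) fpar Upar.
have v0 : (Re (beta *+ 2), Im (beta *+ 2)) != (0, 0).
  have : beta *+ 2 != 0 by rewrite mulrn_eq0.
  by apply: contra_neq; case: (beta *+ 2) => u v /= [-> ->].
case=> x y.
suff : normc (f (x +i* y)) ^+ 2 * expR (- normc (x +i* y) ^+ 2) = 0.
  move/eqP; rewrite mulf_eq0 (gt_eqF (expR_gt0 _)) orbF.
  by rewrite sqrf_eq0 normc_eq0 => /eqP.
apply: (@periodic_integrable_eq0 R _ _ _ v0 (continuous_fock_density holf)
  _ _ (fock_sqnorm_lty fI) (x, y)).
  by move=> p; rewrite mulr_ge0 ?sqr_ge0 ?expR_ge0.
by move=> u v; have := per (u +i* v); case: (beta *+ 2).
Qed.
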